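(* The following subsumptions between query languages over data graphs hold: (i) RDPQ is subsumed by FO(RDPQ), and FO(RDPQ) is subsumed by FO(ERDPQ); (ii) GPC is subsumed by FO(ERDPQ); (iii) WL is subsumed by FO(ERDPQ); (iv) RDPQ is subsumed by FO$^*(\equiv_{\mathrm{data}})$; (v) GXPath$_{\mathrm{reg}}(\equiv_{\mathrm{data}})$ is subsumed by FO$^*(\equiv_{\mathrm{data}})$.
   Context: Data graphs. Fix a finite alphabet $\Sigma$ and infinite data domains $\mathcal D_{\mathrm{id}}$ and $\mathcal D_{\mathrm{prop}}$. A data graph is $G=(V,E,\mathrm{id},\mathrm{dataof})$ with $V$ a finite nonempty set of nodes, $E\subseteq V\times\Sigma\times V$, $\mathrm{id}:V\to\mathcal D_{\mathrm{id}}$ injective and $\mathrm{dataof}:V\to\mathcal D_{\mathrm{prop}}$. A path is a sequence $\rho=v_0a_1v_1\cdots a_nv_n$ ($n\ge 0$) with $(v_{i-1},a_i,v_i)\in E$ for all $i$; its length is $n$, its positions are $0,\dots,n$, and it is simple if $v_0,\dots,v_n$ are pairwise distinct. Its data path is $d_0a_1d_1\cdots a_nd_n$ with $d_i=(\mathrm{id}(v_i),\mathrm{dataof}(v_i))$. Queries and subsumption. A query of a language is the function assigning to each data graph and each assignment of its free variables a truth value. Language $L$ is subsumed by $L'$ if every query expressible in $L$ is expressible in $L'$ (for query languages returning paths, such as GPC, also the Boolean query ''the answer set is nonempty'' is considered). RDPA. An $n$-ary register data path automaton (RDPA) has finitely many states partitioned into word states and data states, an initial data state, a set of final word states, and finitely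 many registers, each an id-register (values in $\mathcal D_{\mathrm{id}}\cup\{\sharp\}$) or a data-register (values in $\mathcal D_{\mathrm{prop}}\cup\{\sharp\}$), all initially $\sharp$. It reads words alternating between data letters and word letters, starting and ending with a data letter. From a word state it reads a letter of $(\Sigma\cup\{\sharp\})^n$ via a transition $p\xrightarrow{a}q$ to a data state, leaving registers unchanged. From a data state it reads a data letter (an $n$-tuple of ids and an $n$-tuple of property values, each possibly $\sharp$) via a transition whose guard is a conjunction of (well-typed) equalities/disequalities between registers, input components and constants, and whose update assigns to some registers an input component, a register value or a constant; it then moves to a word state. It accepts nondeterministically if some run ends in a final state. A tuple $(u_1,\dots,u_n)$ of data paths is accepted if their convolution (position-wise tuple, shorter ones padded with $\sharp$ to the length of the longest) is accepted. FO(ERDPQ). Formulas use node variables (ranging over $V$) and path variables (ranging over paths of $G$). Atoms: $\pi=\omega$; $x=y$; $(x,\pi,y)$ (''$\pi$ is a path from $x$ to $y$''); $(\pi_1,\dots,\pi_n)\in A$ for an $n$-ary RDPA $A$ (''the tuple of data paths of $\pi_1,\dots,\pi_n$ is accepted by $A$''). Formulas are closed under $\neg,\wedge,\exists x,\exists\pi$ with standard semantics. FO(RDPQ) is the fragment where all RDPAs are unary. RDPQ consists of the formulas $\exists\pi.\,(x,\pi,y)\wedge \pi\in A$ with $A$ unary. FO$^*(\equiv_{\mathrm{data}})$. First-order logic over node variables with binary relations $E_a=\{(v,v'):(v,a,v')\in E\}$ for $a\in\Sigma$, $\equiv_{\mathrm{data}}=\{(v,v'):\mathrm{dataof}(v)=\mathrm{dataof}(v')\}$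 and equality, closed additionally under the operator: if $\phi(\bar x,\bar y)$ is a formula with $\bar x,\bar y$ tuples of node variables of equal arity, then $\phi^*(\bar x,\bar y)$ is a formula, true at $(\bar u,\bar u')$ iff there are tuples $\bar u_1=\bar u,\dots,\bar u_k=\bar u'$ ($k\ge1$) with $\phi(\bar u_i,\bar u_{i+1})$ for all $i<k$ (other free variables fixed). FO$^*_3(\equiv_{\mathrm{data}})$ is the fragment in which every subformula has at most three free variables. GXPath$_{\mathrm{reg}}(\equiv_{\mathrm{data}})$ is the graph XPath language of Libkin, Martens and Vrgoč, known to have exactly the expressive power of FO$^*_3(\equiv_{\mathrm{data}})$. WL (walk logic). Path variables $\pi,\omega,\dots$ range over paths; each position variable $\ell^\pi$ has a sort $\pi$ and ranges over positions of the path assigned to $\pi$. Atoms: $E_a(\ell^\pi,m^\pi)$ ($m=\ell+1$ and the $m$-th label of the path is $a$); $\ell^\pi<m^\pi$ (same sort only); $\ell^\pi\equiv_{\mathrm{id}} n^\omega$ (the nodes at these positions are equal); $\ell^\pi\equiv_{\mathrm{data}} n^\omega$ (these nodes have equal $\mathrm{dataof}$). Closed under $\neg,\vee,\exists\ell^\pi,\exists\pi$. GPC (graph pattern calculus, forward edges only). Patterns: $()$, $(x)$ ($x$ a node variable), $\rightarrow$, $\xrightarrow{a}$ ($a\in\Sigma$); if $\mathfrak p,\mathfrak p'$ are patterns then so are $\mathfrak p+\mathfrak p'$, $\mathfrak p\mathfrak p'$, $\mathfrak p^{n..m}$ ($n\in\mathbb N$, $m\in\mathbb N\cup\{\infty\}$)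 and $\mathfrak p_{\langle\theta\rangle}$, where conditions are $\theta::=x\equiv_{\mathrm{data}}y\mid\neg\theta\mid\theta\wedge\theta$. A variable occurring in a repetition subpattern $\mathfrak q$ of $\mathfrak p$ may not occur in $\mathfrak p$ outside $\mathfrak q$; variables not inside any repetition are free ($\mathrm{fv}(\mathfrak p)$). The semantics $[\![\mathfrak p]\!]_G$ is a set of pairs $(\rho,\mu)$, $\rho$ a path, $\mu:\mathrm{fv}(\mathfrak p)\to V\cup\{\sharp\}$: $[\![()]\!]=\{(v,\emptyset)\}$; $[\![(x)]\!]=\{(v,\{x\mapsto v\})\}$; $[\![\rightarrow]\!]=\{(vav',\emptyset):(v,a,v')\in E\}$; $[\![\xrightarrow{a}]\!]$ likewise with fixed $a$; $[\![\mathfrak p+\mathfrak p']\!]$ contains $(\rho,\hat\mu)$ for $(\rho,\mu)\in[\![\mathfrak p]\!]\cup[\![\mathfrak p']\!]$, $\hat\mu$ extending $\mu$ by $\sharp$; $[\![\mathfrak p\mathfrak p']\!]=\{(\rho\cdot\rho',\mu\cup\mu')\}$ over $(\rho,\mu)\in[\![\mathfrak p]\!]$, $(\rho',\mu')\in[\![\mathfrak p']\!]$ where $\rho$ ends where $\rho'$ starts and $\mu,\mu'$ agree on common variables where both are non-$\sharp$ (the union takes the non-$\sharp$ value when present); $[\![\mathfrak p^{n..m}]\!]=\bigcup_{i=n}^m\{(\rho_1\cdots\rho_i,\emptyset): \text{each }\rho_j\text{ satisfies }\mathfrak p\}$ (for $i=0$ this is $[\![()]\!]$); $[\![\mathfrak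 p_{\langle\theta\rangle}]\!]=\{(\rho,\mu)\in[\![\mathfrak p]\!]:\mu\models\theta\}$ with $\mu\models x\equiv_{\mathrm{data}}y$ iff $\mathrm{dataof}(\mu(x))=\mathrm{dataof}(\mu(y))$. A GPC query is $\mathfrak t\,\mathfrak p$ with restrictor $\mathfrak t$: SIMPLE keeps pairs with $\rho$ simple; SHORTEST keeps pairs whose $\rho$ has minimal length among paths in $[\![\mathfrak p]\!]$ with the same endpoints; SHORTESTSIMPLE keeps simple $\rho$ of minimal length among simple paths in $[\![\mathfrak p]\!]$ with the same endpoints. A path $\rho$ is in $[\![Q]\!]_G$ if $(\rho,\mu)\in[\![Q]\!]_G$ for some $\mu$; $G$ satisfies $Q$ if $[\![Q]\!]_G\neq\emptyset$.
   Formalization: The only constant allowed in guards and updates of register data path automata is ♯; with constants from the infinite data domains, (iv) fails because FO*(≡data) has no constants and is invariant under renaming data values. *)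

(* Defs.v *)
From Stdlib Require Import Relations.Relation_Operators.
From Stdlib Require List.
From mathcomp Require Import all_boot.

Set Implicit Arguments.
Unset Strict Implicit.
Unset Printing Implicit Defensive.

Section DataGraphs.

Variables (Sigma : finType) (Did Dprop : Type).

Record dgraph := DGraph {
  V : finType;
  E : V -> Sigma -> V -> bool;
  gid : V -> Did;
  gid_inj : injective gid;
  dataof : V -> Dprop;
  V_nonempty : 0 < #|V|
}.

(* raw path v0 a1 v1 ... an vn, represented as (v0, [(a1,v1);...;(an,vn)]) *)
Definition rawpath (G : dgraph) : Type := (V G * seq (Sigma * V G))%type.

Fixpoint valid_steps (G : dgraph) (v : V G) (s : seq (Sigma * V G)) : bool :=
  match s with
  | [::] => true
  | (a, w) :: s' => E v a w && valid_steps w s'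
  end.

Definition is_path (G : dgraph) (r : rawpath G) : bool := valid_steps r.1 r.2.

Definition gpath (G : dgraph) : Type := {r : rawpath G | is_path r}.

Definition plen (G : dgraph) (r : rawpath G) : nat := size r.2.
Definition pfirst (G : dgraph) (r : rawpath G) : V G := r.1.
Definition plast (G : dgraph) (r : rawpath G) : V G := last r.1 (map snd r.2).
Definition pnodes (G : dgraph) (r : rawpath G) : seq (V G) := r.1 :: map snd r.2.
Definition psimple (G : dgraph) (r : rawpath G) : bool := uniq (pnodes r).

Definition posnode (G : dgraph) (r : rawpath G) (j : nat) : option (V G) :=
  if j is j'.+1 then omap snd (onth r.2 j') else Some r.1.
(* j-th label a_j (1 <= j <= length), None otherwise *)
Definition poslab (G : dgraph) (r : rawpath G) (j : nat) : option Sigma :=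
  if j is j'.+1 then omap fst (onth r.2 j') else None.

(* concatenation rho . rho' (meaningful when plast rho = pfirst rho') *)
Definition pcat (G : dgraph) (r r' : rawpath G) : rawpath G := (r.1, r.2 ++ r'.2).

(* n = arity, nid = number of id-registers, ndat = number of
   data-registers.  The only constant is the undefined value #
   (represented by None). *)

Inductive idterm (n nid : nat) :=
| IdReg of 'I_nid | IdIn of 'I_n | IdSharp.
Inductive dterm (n ndat : nat) :=
| DReg of 'I_ndat | DIn of 'I_n | DSharp.

Inductive gatom (n nid ndat : nat) :=
| AIdEq of idterm n nid & idterm n nid
| AIdNeq of idterm n nid & idterm n nid
| ADEq of dterm n ndat & dterm n ndat
| ADNeq of dterm n ndat & dterm n ndat.

(* update: None = register unchanged *)
Record update (n nid ndat : nat) := Update {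
  upd_id : 'I_nid -> option (idterm n nid);
  upd_dat : 'I_ndat -> option (dterm n ndat)
}.

Record rdpa (n : nat) := RDPA {
  Qw : finType;
  Qd : finType;
  q0 : Qd;
  qfin : pred Qw;
  nid : nat;
  ndat : nat;
  wtrans : Qw -> {ffun 'I_n -> option Sigma} -> Qd -> bool;
  dtrans : seq (Qd * seq (gatom n nid ndat) * update n nid ndat * Qw)
}.

Definition dletter (n : nat) : Type :=
  (('I_n -> option Did) * ('I_n -> option Dprop))%type.
Definition wletter (n : nat) : Type := {ffun 'I_n -> option Sigma}.
Definition rword (n : nat) : Type := (dletter n * seq (wletter n * dletter n))%type.

Section RDPASem.
Variables (n : nat) (A : rdpa n).

Definition regs : Type :=
  (('I_(nid A) -> option Did) * ('I_(ndat A) -> option Dprop))%type.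

Definition eval_id (rho : regs) (d : dletter n) (t : idterm n (nid A)) : option Did :=
  match t with IdReg r => rho.1 r | IdIn i => d.1 i | IdSharp => None end.
Definition eval_d (rho : regs) (d : dletter n) (t : dterm n (ndat A)) : option Dprop :=
  match t with DReg r => rho.2 r | DIn i => d.2 i | DSharp => None end.

Definition atom_holds (rho : regs) (d : dletter n) (g : gatom n (nid A) (ndat A)) : Prop :=
  match g with
  | AIdEq t1 t2 => eval_id rho d t1 = eval_id rho d t2
  | AIdNeq t1 t2 => eval_id rho d t1 <> eval_id rho d t2
  | ADEq t1 t2 => eval_d rho d t1 = eval_d rho d t2
  | ADNeq t1 t2 => eval_d rho d t1 <> eval_d rho d t2
  end.

Definition do_update (rho : regs) (d : dletter n) (u : update n (nid A) (ndat A)) : regs :=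
  (fun r => if upd_id u r is Some t then eval_id rho d t else rho.1 r,
   fun r => if upd_dat u r is Some t then eval_d rho d t else rho.2 r).

Fixpoint acc_from (q : Qd A) (rho : regs) (d : dletter n)
    (rest : seq (wletter n * dletter n)) : Prop :=
  exists g u q',
    List.In (q, g, u, q') (dtrans A) /\
    (forall a, List.In a g -> atom_holds rho d a) /\
    let rho' := do_update rho d u in
    match rest with
    | [::] => @qfin _ A q'
    | (a, d') :: rest' => exists q'', @wtrans _ A q' a q'' /\ acc_from q'' rho' d' rest'
    end.

Definition rdpa_accepts (w : rword n) : Prop :=
  acc_from (q0 A) (fun _ => None, fun _ => None) w.1 w.2.
End RDPASem.

Definition conv_dletter (G : dgraph) (n : nat) (ps : 'I_n -> rawpath G) (j : nat)
  : dletter n :=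
  (fun i => omap (@gid G) (posnode (ps i) j),
   fun i => omap (@dataof G) (posnode (ps i) j)).
Definition conv_wletter (G : dgraph) (n : nat) (ps : 'I_n -> rawpath G) (j : nat)
  : wletter n := [ffun i => poslab (ps i) j].
Definition convolution (G : dgraph) (n : nat) (ps : 'I_n -> rawpath G) : rword n :=
  let L := \max_(i < n) plen (ps i) in
  (conv_dletter ps 0,
   [seq (conv_wletter ps j, conv_dletter ps j) | j <- iota 1 L]).

(* Node variables and path variables are named by natural numbers (two
   separate namespaces); a query maps a data graph and an assignment of
   node and path variables to a truth value. *)

Record language := Language {
  lform : Type;
  lsem : lform -> forall G : dgraph, (nat -> V G) -> (nat -> gpath G) -> Prop
}.

Definition subsumed (L1 L2 : language) : Prop :=
  forall phi : lform L1, exists psi : lform L2,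
    forall (G : dgraph) (nu : nat -> V G) (eta : nat -> gpath G),
      lsem phi nu eta <-> lsem psi nu eta.

Definition upd {T : Type} (f : nat -> T) (x : nat) (v : T) : nat -> T :=
  fun y => if y == x then v else f y.

Inductive foe :=
| FPathEq of nat & nat
| FNodeEq of nat & nat
| FEnds of nat & nat & nat
| FIn (n : nat) of rdpa n & ('I_n -> nat)
| FNot of foe
| FAnd of foe & foe
| FExN of nat & foe
| FExP of nat & foe.

Fixpoint foe_sat (G : dgraph) (phi : foe) (nu : nat -> V G) (eta : nat -> gpath G)
  : Prop :=
  match phi with
  | FPathEq p q => proj1_sig (eta p) = proj1_sig (eta q)
  | FNodeEq x y => nu x = nu y
  | FEnds x p y => pfirst (proj1_sig (eta p)) = nu x /\ plast (proj1_sig (eta p)) = nu y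
  | FIn n A ps => rdpa_accepts A (convolution (fun i => proj1_sig (eta (ps i))))
  | FNot f => ~ foe_sat f nu eta
  | FAnd f g => foe_sat f nu eta /\ foe_sat g nu eta
  | FExN x f => exists v : V G, foe_sat f (upd nu x v) eta
  | FExP p f => exists r : gpath G, foe_sat f nu (upd eta p r)
  end.

Fixpoint foe_unary (phi : foe) : bool :=
  match phi with
  | FIn n _ _ => n == 1
  | FNot f | FExN _ f | FExP _ f => foe_unary f
  | FAnd f g => foe_unary f && foe_unary g
  | _ => true
  end.

Definition FOERDPQ : language := Language (fun phi G => @foe_sat G phi).

Definition FORDPQ : language :=
  Language (fun (phi : {f : foe | foe_unary f}) G => @foe_sat G (proj1_sig phi)).

Definition RDPQ : language :=
  Language (fun (q : (nat * nat * rdpa 1)%type) G nu eta =>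
    exists r : gpath G,
      pfirst (proj1_sig r) = nu q.1.1 /\ plast (proj1_sig r) = nu q.1.2 /\
      rdpa_accepts q.2 (convolution (fun _ : 'I_1 => proj1_sig r))).

Inductive fos :=
| SE of Sigma & nat & nat
| SData of nat & nat
| SEq of nat & nat
| SNot of fos
| SAnd of fos & fos
| SEx of nat & fos
| SStar of seq nat & seq nat & fos.

Fixpoint updl {T : Type} (f : nat -> T) (xs : seq nat) (vs : seq T) : nat -> T :=
  match xs, vs with
  | x :: xs', v :: vs' => updl (upd f x v) xs' vs'
  | _, _ => f
  end.

Fixpoint fos_sat (G : dgraph) (phi : fos) (nu : nat -> V G) : Prop :=
  match phi with
  | SE a x y => E (nu x) a (nu y)
  | SData x y => dataof (nu x) = dataof (nu y)
  | SEq x y => nu x = nu y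
  | SNot f => ~ fos_sat f nu
  | SAnd f g => fos_sat f nu /\ fos_sat g nu
  | SEx x f => exists v : V G, fos_sat f (upd nu x v)
  | SStar xs ys f =>
      clos_refl_trans_1n (seq (V G))
        (fun us us' => size us = size xs /\ size us' = size xs /\
                       fos_sat f (updl (updl nu xs us) ys us'))
        (map nu xs) (map nu ys)
  end.

Fixpoint fos_wf (phi : fos) : bool :=
  match phi with
  | SNot f | SEx _ f => fos_wf f
  | SAnd f g => fos_wf f && fos_wf g
  | SStar xs ys f => (size xs == size ys) && uniq (xs ++ ys) && fos_wf f
  | _ => true
  end.

Definition FOStar : language :=
  Language (fun (phi : {f : fos | fos_wf f}) G nu _ => @fos_sat G (proj1_sig phi) nu).

Inductive gxnode :=
| XTop
| XNot of gxnode
| XAnd of gxnode & gxnode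
| XDiam of gxpath
| XEqP of gxpath & gxpath
| XNeqP of gxpath & gxpath
with gxpath :=
| XEps
| XAny
| XLab of Sigma
| XInv of Sigma
| XTest of gxnode
| XComp of gxpath & gxpath
| XUnion of gxpath & gxpath
| XCompl of gxpath
| XStar of gxpath
| XEqD of gxpath
| XNeqD of gxpath.

Fixpoint gxn_sat (G : dgraph) (phi : gxnode) (v : V G) : Prop :=
  match phi with
  | XTop => True
  | XNot f => ~ gxn_sat f v
  | XAnd f g => gxn_sat f v /\ gxn_sat g v
  | XDiam a => exists w, gxp_sat a v w
  | XEqP a b => exists w w', gxp_sat a v w /\ gxp_sat b v w' /\ dataof w = dataof w'
  | XNeqP a b => exists w w', gxp_sat a v w /\ gxp_sat b v w' /\ dataof w <> dataof w'
  end
with gxp_sat (G : dgraph) (al : gxpath) (v w : V G) : Prop :=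
  match al with
  | XEps => v = w
  | XAny => exists a, E v a w
  | XLab a => E v a w
  | XInv a => E w a v
  | XTest f => v = w /\ gxn_sat f v
  | XComp a b => exists u, gxp_sat a v u /\ gxp_sat b u w
  | XUnion a b => gxp_sat a v w \/ gxp_sat b v w
  | XCompl a => ~ gxp_sat a v w
  | XStar a => clos_refl_trans_1n (V G) (fun x y => gxp_sat a x y) v w
  | XEqD a => gxp_sat a v w /\ dataof v = dataof w
  | XNeqD a => gxp_sat a v w /\ dataof v <> dataof w
  end.

Definition GXPath : language :=
  Language (fun (q : ((gxnode * nat) + (gxpath * nat * nat))%type) G nu _ =>
    match q with
    | inl (f, x) => gxn_sat f (nu x)
    | inr (a, x, y) => gxp_sat a (nu x) (nu y)
    end).

(* a position variable l^pi is the pair (l, pi) *)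

Inductive wl :=
| WE of Sigma & nat & nat & nat
| WLt of nat & nat & nat
| WId of nat & nat & nat & nat
| WData of nat & nat & nat & nat
| WNot of wl
| WOr of wl & wl
| WExPos of nat & nat & wl
| WExPath of nat & wl.

Definition upd2 {T : Type} (f : nat * nat -> T) (x : nat * nat) (v : T)
  : nat * nat -> T := fun y => if y == x then v else f y.

Fixpoint wl_sat (G : dgraph) (phi : wl) (eta : nat -> gpath G)
    (mu : nat * nat -> nat) : Prop :=
  match phi with
  | WE a l m p =>
      let r := proj1_sig (eta p) in
      mu (l, p) <= plen r /\ mu (m, p) <= plen r /\
      mu (m, p) = (mu (l, p)).+1 /\ poslab r (mu (m, p)) = Some a
  | WLt l m p =>
      let r := proj1_sig (eta p) in
      mu (l, p) <= plen r /\ mu (m, p) <= plen r /\ mu (l, p) < mu (m, p)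
  | WId l p k q =>
      exists v w, posnode (proj1_sig (eta p)) (mu (l, p)) = Some v /\
                  posnode (proj1_sig (eta q)) (mu (k, q)) = Some w /\ v = w
  | WData l p k q =>
      exists v w, posnode (proj1_sig (eta p)) (mu (l, p)) = Some v /\
                  posnode (proj1_sig (eta q)) (mu (k, q)) = Some w /\
                  dataof v = dataof w
  | WNot f => ~ wl_sat f eta mu
  | WOr f g => wl_sat f eta mu \/ wl_sat g eta mu
  | WExPos l p f =>
      exists i, i <= plen (proj1_sig (eta p)) /\ wl_sat f eta (upd2 mu (l, p) i)
  | WExPath p f => exists r : gpath G, wl_sat f (upd eta p r) mu
  end.

Fixpoint wl_fpv (phi : wl) : seq (nat * nat) :=
  match phi with
  | WE _ l m p => [:: (l, p); (m, p)]
  | WLt l m p => [:: (l, p); (m, p)]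
  | WId l p k q => [:: (l, p); (k, q)]
  | WData l p k q => [:: (l, p); (k, q)]
  | WNot f | WExPath _ f => wl_fpv f
  | WOr f g => wl_fpv f ++ wl_fpv g
  | WExPos l p f => filter (predC1 (l, p)) (wl_fpv f)
  end.

Definition WL : language :=
  Language (fun (phi : {f : wl | wl_fpv f == [::]}) G _ eta =>
    @wl_sat G (proj1_sig phi) eta (fun _ => 0)).

(* GPC (graph pattern calculus, forward edges only)                    *)

Inductive gcond :=
| CData of nat & nat
| CNot of gcond
| CAnd of gcond & gcond.

Inductive pattern :=
| PEmpty
| PVar of nat
| PEdge
| PLab of Sigma
| PUnion of pattern & pattern
| PConc of pattern & pattern
| PRep of pattern & nat & option nat      (* p^{n..m}, None = infinity *)
| PCond of pattern & gcond.

Fixpoint cond_vars (t : gcond) : seq nat :=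
  match t with
  | CData x y => [:: x; y]
  | CNot t' => cond_vars t'
  | CAnd t1 t2 => cond_vars t1 ++ cond_vars t2
  end.

Fixpoint pvars (p : pattern) : seq nat :=
  match p with
  | PVar x => [:: x]
  | PUnion p1 p2 | PConc p1 p2 => pvars p1 ++ pvars p2
  | PRep p' _ _ => pvars p'
  | PCond p' t => pvars p' ++ cond_vars t
  | _ => [::]
  end.

Fixpoint prepvars (p : pattern) : seq nat :=
  match p with
  | PUnion p1 p2 | PConc p1 p2 => prepvars p1 ++ prepvars p2
  | PRep p' _ _ => pvars p'
  | PCond p' _ => prepvars p'
  | _ => [::]
  end.

(* a variable occurring in a repetition subpattern q of p does not occur
   in p outside q *)
Fixpoint pwf (p : pattern) : bool :=
  match p with
  | PUnion p1 p2 | PConc p1 p2 =>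
      [&& pwf p1, pwf p2,
          all (fun x => x \notin pvars p2) (prepvars p1) &
          all (fun x => x \notin pvars p1) (prepvars p2)]
  | PRep p' _ _ => pwf p'
  | PCond p' t => pwf p' && all (fun x => x \notin cond_vars t) (prepvars p')
  | _ => true
  end.

(* mu : variable -> V + {#}; # (and "not in domain") = None *)
Fixpoint cond_sat (G : dgraph) (mu : nat -> option (V G)) (t : gcond) : Prop :=
  match t with
  | CData x y => exists v w, mu x = Some v /\ mu y = Some w /\ dataof v = dataof w
  | CNot t' => ~ cond_sat mu t'
  | CAnd t1 t2 => cond_sat mu t1 /\ cond_sat mu t2
  end.

Fixpoint chain (G : dgraph) (rs : seq (rawpath G)) (rho : rawpath G) : Prop :=
  match rs with
  | [::] => rho.2 = [::]
  | r :: rs' => exists rho', chain rs' rho' /\ pfirst rho' = plast r /\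
                            rho = pcat r rho'
  end.

Fixpoint pat_sem (G : dgraph) (p : pattern) (rho : rawpath G)
    (mu : nat -> option (V G)) : Prop :=
  match p with
  | PEmpty => rho.2 = [::] /\ forall z, mu z = None
  | PVar x => rho.2 = [::] /\ forall z, mu z = (if z == x then Some rho.1 else None)
  | PEdge => (exists a v', rho.2 = [:: (a, v')] /\ E rho.1 a v') /\
             forall z, mu z = None
  | PLab a => (exists v', rho.2 = [:: (a, v')] /\ E rho.1 a v') /\
             forall z, mu z = None
  | PUnion p1 p2 => pat_sem p1 rho mu \/ pat_sem p2 rho mu
  | PConc p1 p2 =>
      exists r1 m1 r2 m2, pat_sem p1 r1 m1 /\ pat_sem p2 r2 m2 /\
        plast r1 = pfirst r2 /\ rho = pcat r1 r2 /\
        (forall z v w, m1 z = Some v -> m2 z = Some w -> v = w) /\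
        (forall z, mu z = (if m1 z is Some v then Some v else m2 z))
  | PRep p' lo hi =>
      (forall z, mu z = None) /\
      exists rs : seq (rawpath G),
        lo <= size rs /\ (if hi is Some h then size rs <= h else True) /\
        (forall r, List.In r rs -> exists m, pat_sem p' r m) /\
        chain rs rho
  | PCond p' t => pat_sem p' rho mu /\ cond_sat mu t
  end.

Inductive restrictor := SIMPLE | SHORTEST | SHORTESTSIMPLE.

Definition gpc_sem (G : dgraph) (t : restrictor) (p : pattern) (rho : rawpath G)
    (mu : nat -> option (V G)) : Prop :=
  pat_sem p rho mu /\
  match t with
  | SIMPLE => psimple rho
  | SHORTEST =>
      forall r m, pat_sem p r m -> pfirst r = pfirst rho -> plast r = plast rho ->
        plen rho <= plen r
  | SHORTESTSIMPLE =>
      psimple rho /\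
      forall r m, pat_sem p r m -> psimple r -> pfirst r = pfirst rho ->
        plast r = plast rho -> plen rho <= plen r
  end.

(* A GPC query (t, p) with p well-formed, together with a choice of the
   query considered: Some k = the path query "path variable k is in
   [[t p]]_G", None = the Boolean query "[[t p]]_G is nonempty". *)
Definition GPC : language :=
  Language (fun (q : ({p : pattern | pwf p} * restrictor * option nat)%type) G _ eta =>
    match q.2 with
    | Some k => exists mu, gpc_sem q.1.2 (proj1_sig q.1.1) (proj1_sig (eta k)) mu
    | None => exists (rho : rawpath G) mu, gpc_sem q.1.2 (proj1_sig q.1.1) rho mu
    end).

End DataGraphs.

(* Main.v *)
(* Translating into FO(ERDPQ).  A position of a path is represented by any path of
   that length, so the atoms of walk logic reduce to registerless automata comparing
   two paths letter by letter (prefix, length).  A GPC pattern is unfolded into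
   finitely many pairs of a domain of bound variables and a regular expression over
   register actions: once the domain is fixed, each occurrence of a variable is
   statically a binding or an equality check, and each condition is a boolean
   combination of register comparisons.  Partial derivatives turn such an
   expression into an RDPA, whose guards summarize the tests made at one node.
   Restrictors are first order over prefixes and lengths.

   Translating into FO*.  A run of a unary RDPA moves through finitely many control
   states (state, set of defined registers) while transforming a tuple of nodes that
   carry the register values.  Kleene's elimination of control states only uses
   union, composition and iteration of tuple relations, so states need not be
   encoded as nodes, which would be impossible in a one-node graph. *)
From HB Require Import structures.
Require Import Defs.
From Stdlib Require List.
From Stdlib Require Import Relations.Relation_Operators.
From Stdlib Require Import Classical FunctionalExtensionality.
From mathcomp Require Import all_boot zify.

Set Implicit Arguments.
Unset Strict Implicit.
Unset Printing Implicit Defensive.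

(** * First-order logic with transitive closure *)

Arguments SEq {Sigma}.
Arguments SData {Sigma}.
Arguments FPathEq {Sigma}.
Arguments FNodeEq {Sigma}.
Arguments FEnds {Sigma}.

(** Nodes can carry register contents because the undefined value is the only constant: every
    defined value was read at some node of the path, and that node can stand for it, ids being
    injective. An automaton reads each data letter exactly once, whereas zero-length patterns
    compose, so a pattern may bind and check many times at one node, and a check made after a
    binding sees the new value. The tests are therefore executed symbolically and rephrased as
    conditions on the registers as they were before the letter. The domain of bound variables must
    be fixed statically because the branches of a union bind different variables, and an atomic
    condition on an undefined variable is false while its negation is true. Iterations of a
    repetition are independent of each other but must respect the bindings made outside. Registers
    are therefore indexed by variable and repetition depth: an iteration overwrites what an earlier
    one left at its own depth and never touches the enclosing depths. *)

Lemma upd_same T (f : nat -> T) x v : upd f x v x = v.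
Proof. by rewrite /upd eqxx. Qed.

Lemma upd_other T (f : nat -> T) x v y : y <> x -> upd f x v y = f y.
Proof. by rewrite /upd; case: eqP. Qed.

Ltac updE :=
  repeat first [rewrite upd_same | rewrite upd_other; last by lia].

Lemma rt1n_mono T (R R' : T -> T -> Prop) x y :
  (forall a b, R a b -> R' a b) ->
  clos_refl_trans_1n T R x y -> clos_refl_trans_1n T R' x y.
Proof.
by move=> sub; elim=> [a|a b c /sub Rab _ IH]; [left | right with b].
Qed.

Lemma rt1n_trans T (R : T -> T -> Prop) x y z :
  clos_refl_trans_1n T R x y -> clos_refl_trans_1n T R y z ->
  clos_refl_trans_1n T R x z.
Proof. by elim=> // a b c Rab _ IH /IH; right with b. Qed.

Lemma rt1n_snoc T (R : T -> T -> Prop) x y z :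
  clos_refl_trans_1n T R x y -> R y z -> clos_refl_trans_1n T R x z.
Proof. by move=> xy yz; apply: rt1n_trans xy _; right with z => //; left. Qed.

Lemma InP (T : eqType) (x : T) (s : seq T) : reflect (List.In x s) (x \in s).
Proof.
elim: s => [|y s IH] /=; first by right.
rewrite in_cons; apply: (iffP orP) => [[/eqP->|/IH]|[->|/IH]]; by [left|right|left|right].
Qed.

Lemma In_map A B (f : A -> B) y s :
  List.In y (map f s) <-> exists2 x, List.In x s & y = f x.
Proof.
elim: s => [|z s IH] /=; first by split=> // -[].
rewrite IH; split=> [[<-|[x xs ->]]|[x [->|xs] ->]].
- by exists z => //; left.
- by exists x => //; right.
- by left.
- by right; exists x.
Qed.

(** * Finite connectives and graph XPath in FO* *)

Section FOStarFormulas.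
Variables (Sigma : finType) (Did Dprop : Type).
Implicit Types (G : dgraph Sigma Did Dprop) (phi : fos Sigma).

Definition STrue : fos Sigma := SEq 0 0.
Definition SOr phi psi := SNot (SAnd (SNot phi) (SNot psi)).
Definition SBigOr := foldr SOr (SNot STrue).
Definition SBigAnd := foldr (@SAnd Sigma) STrue.

Lemma SOr_sat G phi psi (nu : nat -> V G) :
  fos_sat (SOr phi psi) nu <-> fos_sat phi nu \/ fos_sat psi nu.
Proof. by rewrite /=; tauto. Qed.

Lemma SBigOr_sat A (F : A -> fos Sigma) s G (nu : nat -> V G) :
  fos_sat (SBigOr (map F s)) nu <-> exists2 a, List.In a s & fos_sat (F a) nu.
Proof.
elim: s => [|b s IH]; first by split=> [/(_ erefl)|[]].
rewrite [SBigOr _]/= SOr_sat IH; split=> [[Fb|[a sa Fa]]|[a [->|sa] Fa]].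
- by exists b => //; left.
- by exists a => //; right.
- by left.
- by right; exists a.
Qed.

Lemma SBigAnd_sat A (F : A -> fos Sigma) s G (nu : nat -> V G) :
  fos_sat (SBigAnd (map F s)) nu <-> forall a, List.In a s -> fos_sat (F a) nu.
Proof.
elim: s => [|b s IH]; first by [].
rewrite /= IH; split=> [[Fb Fs] a [<-|/Fs]|H] //.
by split=> [|a sa]; apply: H; [left | right].
Qed.

Lemma SBigOr_wf A (F : A -> fos Sigma) s :
  (forall a, List.In a s -> fos_wf (F a)) -> fos_wf (SBigOr (map F s)).
Proof.
elim: s => //= a s IH wfF; rewrite wfF /=; last by left.
by apply: IH => b sb; apply: wfF; right.
Qed.

Lemma SBigAnd_wf A (F : A -> fos Sigma) s :
  (forall a, List.In a s -> fos_wf (F a)) -> fos_wf (SBigAnd (map F s)).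
Proof.
elim: s => //= a s IH wfF; rewrite wfF /=; last by left.
by apply: IH => b sb; apply: wfF; right.
Qed.

(** The truth of each translation depends only on the variables it is given, so any larger index,
    such as [(x + y).+1], is fresh. For [XStar] the endpoints are first copied to [z] and [t]:
    [fos_wf] wants distinct star variables, while [x] and [y] may coincide. *)
Fixpoint fos_of_gxn (f : gxnode Sigma) (x : nat) : fos Sigma :=
  match f with
  | XTop => STrue
  | XNot f => SNot (fos_of_gxn f x)
  | XAnd f g => SAnd (fos_of_gxn f x) (fos_of_gxn g x)
  | XDiam a => SEx x.+1 (fos_of_gxp a x x.+1)
  | XEqP a b => SEx x.+1 (SEx x.+2
      (SAnd (fos_of_gxp a x x.+1) (SAnd (fos_of_gxp b x x.+2) (SData x.+1 x.+2))))
  | XNeqP a b => SEx x.+1 (SEx x.+2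
      (SAnd (fos_of_gxp a x x.+1) (SAnd (fos_of_gxp b x x.+2) (SNot (SData x.+1 x.+2)))))
  end
with fos_of_gxp (a : gxpath Sigma) (x y : nat) : fos Sigma :=
  match a with
  | XEps => SEq x y
  | XAny => SBigOr [seq SE a x y | a <- enum Sigma]
  | XLab a => SE a x y
  | XInv a => SE a y x
  | XTest f => SAnd (SEq x y) (fos_of_gxn f x)
  | XComp a b => SEx (x + y).+1
      (SAnd (fos_of_gxp a x (x + y).+1) (fos_of_gxp b (x + y).+1 y))
  | XUnion a b => SOr (fos_of_gxp a x y) (fos_of_gxp b x y)
  | XCompl a => SNot (fos_of_gxp a x y)
  | XStar a =>
      let z := (x + y).+1 in let t := (x + y).+2 in
      SEx z (SEx t (SAnd (SEq z x) (SAnd (SEq t y)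
        (SStar [:: z] [:: t] (fos_of_gxp a z t)))))
  | XEqD a => SAnd (fos_of_gxp a x y) (SData x y)
  | XNeqD a => SAnd (fos_of_gxp a x y) (SNot (SData x y))
  end.

Scheme gxnode_mut := Induction for gxnode Sort Prop
with gxpath_mut := Induction for gxpath Sort Prop.
Combined Scheme gx_mut from gxnode_mut, gxpath_mut.

Lemma fos_of_gx_wf :
  (forall f x, fos_wf (fos_of_gxn f x)) /\ (forall a x y, fos_wf (fos_of_gxp a x y)).
Proof.
apply: gx_mut => //=; try by move=> *; repeat (apply/andP; split).
- by move=> x y; apply: SBigOr_wf.
- by move=> a IH x y; rewrite IH mem_seq1 /=; lia.
Qed.

Lemma fos_of_gx_sat G :
  (forall f x (nu : nat -> V G), fos_sat (fos_of_gxn f x) nu <-> gxn_sat f (nu x)) /\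
  (forall a x y (nu : nat -> V G),
     fos_sat (fos_of_gxp a x y) nu <-> gxp_sat a (nu x) (nu y)).
Proof.
apply: gx_mut.
- by [].
- by move=> f IH x nu /=; rewrite IH.
- by move=> f IHf g IHg x nu /=; rewrite IHf IHg.
- move=> a IH x nu /=.
  by split=> -[w]; [rewrite IH => H | move=> H]; exists w; move: H; rewrite ?IH; updE.
- move=> a IHa b IHb x nu /=; by split=> -[v [w H]]; exists v, w; move: H;
    rewrite !IHa !IHb; updE.
- move=> a IHa b IHb x nu /=; by split=> -[v [w H]]; exists v, w; move: H;
    rewrite !IHa !IHb; updE.
- by [].
- move=> x y nu; rewrite [fos_of_gxp _ _ _]/= SBigOr_sat /=.
  split=> [[a _ H]|[a H]]; first by exists a.
  by exists a => //; apply/InP; rewrite mem_enum.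
- by [].
- by [].
- by move=> f IH x y nu /=; rewrite IH.
- move=> a IHa b IHb x y nu /=.
  by split=> -[w H]; exists w; move: H; rewrite IHa IHb; updE.
- by move=> a IHa b IHb x y nu; rewrite [fos_of_gxp _ _ _]/= SOr_sat IHa IHb.
- by move=> a IHa x y nu /=; rewrite IHa.
- move=> a IHa x y nu.
  set z := (x + y).+1; set t := (x + y).+2.
  (* [SStar] iterates over lists; its size conditions force all intermediate lists to be singletons,
     which matches the iteration over nodes. *)
  have star (nu' : nat -> V G) : fos_sat (SStar [:: z] [:: t] (fos_of_gxp a z t)) nu' <->
      gxp_sat (XStar a) (nu' z) (nu' t).
    rewrite /=; split.
      move: (nu' z) (nu' t) => v w.
      move Ev: [:: v] => vs; move Ew: [:: w] => ws H.
      elim: H v w Ev Ew => [us v w <- [->]|us1 us2 us3 [_ [s2 H]] _ IH v w Ev Ew].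
        by left.
      case: us2 s2 H IH => // u [|//] _ H IH; right with u; last exact: IH.
      by move: H; rewrite -Ev /= IHa /z /t; updE.
    move: (nu' z) (nu' t) => v0 w0; elim=> [v|u v w Ruv _ IH]; first by left.
    right with [:: v] => //; split=> //; split=> //=.
    by rewrite IHa /z /t; updE.
  rewrite [fos_of_gxp _ _ _]/= -/z -/t; split.
    case=> v [w [/= Hv [/= Hw /star]]]; move: Hv Hw; rewrite /z /t; updE.
    by move=> -> ->.
  move=> H; exists (nu x), (nu y); split; first by rewrite /= /z /t; updE.
  split; first by rewrite /= /z /t; updE.
  by apply/star; rewrite /z /t; updE.
- by move=> a IHa x y nu /=; rewrite IHa.
- by move=> a IHa x y nu /=; rewrite IHa.
Qed.

Lemma GXPath_FOStar :
  subsumed (GXPath Sigma Did Dprop) (FOStar Sigma Did Dprop).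
Proof.
case=> [[f x]|[[a x] y]].
  exists (exist _ (fos_of_gxn f x) (fos_of_gx_wf.1 f x)) => G nu eta /=.
  by rewrite (fos_of_gx_sat G).1.
exists (exist _ (fos_of_gxp a x y) (fos_of_gx_wf.2 a x y)) => G nu eta /=.
by rewrite (fos_of_gx_sat G).2.
Qed.

End FOStarFormulas.

(** * Kleene elimination and definable tuple relations *)

Section UnaryWords.
Variables (Sigma : finType) (Did Dprop : Type).
Implicit Type G : dgraph Sigma Did Dprop.

Definition node_letter G (v : V G) : dletter Did Dprop 1 :=
  (fun _ => Some (gid v), fun _ => Some (dataof v)).

Definition step_letters G (s : seq (Sigma * V G)) :
  seq (wletter Sigma 1 * dletter Did Dprop 1) :=
  [seq ([ffun=> Some e.1], node_letter e.2) | e <- s].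

(** A single path is never padded, so its convolution, defined through positions, is a plain map
    over its steps, on which runs can be analysed by structural induction. *)
Lemma convolution_unary G (r : rawpath G) :
  convolution (fun _ : 'I_1 => r) = (node_letter r.1, step_letters r.2).
Proof.
congr (_, _); rewrite big_ord_recl big_ord0 maxn0 /plen.
case: r => v s /=.
have -> : [seq (conv_wletter (fun _ : 'I_1 => (v, s)) j,
               conv_dletter (fun _ : 'I_1 => (v, s)) j) | j <- iota 1 (size s)] =
  [seq ([ffun=> omap fst (onth s j)],
        (fun=> omap (@gid _ _ _ G) (omap snd (onth s j)),
         fun=> omap (@dataof _ _ _ G) (omap snd (onth s j)))) | j <- iota 0 (size s)].
  by rewrite -[1]addn0 iotaDl -map_comp.
elim: s => //= e s IH; congr (_ :: _).
by rewrite -IH -[1]addn0 iotaDl -map_comp.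
Qed.

End UnaryWords.

(** * Kleene's elimination of control states *)

Section Kleene.
Variables (I T : Type) (r : I -> I -> T -> T -> Prop).

(** These are the nonempty runs from [i] to [j] whose intermediate states lie in [l]: such a run
    avoids the head [k] or is cut at its visits to [k]. *)
Fixpoint kleene (l : seq I) (i j : I) : T -> T -> Prop :=
  if l is k :: l' then fun t t' =>
    kleene l' i j t t' \/
    exists s', (exists2 s, kleene l' i k t s & clos_refl_trans_1n T (kleene l' k k) s s') /\
               kleene l' k j s' t'
  else r i j.

Definition steps (c c' : I * T) : Prop :=
  clos_refl_trans_1n (I * T) (fun c c' => r c.1 c'.1 c.2 c'.2) c c'.

Lemma kleene_steps l i j t t' : kleene l i j t t' -> steps (i, t) (j, t').
Proof.
elim: l i j t t' => /= [|k l IH] i j t t'; first by right with (j, t') => //; left.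
case=> [/IH //|[s' [[s /IH is_ ks] /IH kj]]].
apply: rt1n_trans is_ _; apply: rt1n_trans kj.
elim: ks => [a|a b c /IH ab _ bc]; first by left.
exact: rt1n_trans ab bc.
Qed.

Lemma kleene_step l i j t t' : r i j t t' -> kleene l i j t t'.
Proof. by elim: l => //= k l IH /IH; left. Qed.

(** If [k] is the head of the list, the gluing point becomes one more visit in the loop at [k].
    Otherwise, when both halves visit the head, the piece from its last visit in the first half to
    its first visit in the second is glued by induction into one turn of the loop. *)
Lemma kleene_trans l k i j t s t' : List.In k l ->
  kleene l i k t s -> kleene l k j s t' -> kleene l i j t t'.
Proof.
elim: l k i j t s t' => //= k0 l IH k i j t s t' [<-|kl].
  case=> [ik|[s1 [[s0 ik0 st0] k0k]]] [kj|[s3 [[s2 kk0 st2] k0j]]]; right.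
  - by exists s; split=> //; exists s => //; left.
  - exists s3; split=> //; exists s => //; right with s2 => //.
  - by exists s; split=> //; exists s0 => //; apply: rt1n_snoc st0 _.
  - exists s3; split=> //; exists s0 => //; apply: rt1n_trans st0 _.
    by right with s => //; right with s2.
case=> [ik|[s1 [[s0 ik0 st0] k0k]]] [kj|[s3 [[s2 kk0 st2] k0j]]].
- by left; apply: IH kj.
- by right; exists s3; split=> //; exists s2 => //; apply: IH kk0.
- by right; exists s1; split; [exists s0|apply: IH kj].
- right; exists s3; split=> //; exists s0 => //; apply: rt1n_trans st0 _.
  by right with s2 => //; apply: IH kk0.
Qed.

(** The equality disjunct accounts for the empty run, which [kleene] leaves out. *)
Lemma steps_kleene l c c' : (forall k, List.In k l) -> steps c c' ->
  c = c' \/ kleene l c.1 c'.1 c.2 c'.2.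
Proof.
move=> full; elim=> [a|a b d ab _ [<-|bd]]; first by left.
- by right; apply: kleene_step.
- by right; apply: kleene_trans (full b.1) (kleene_step _ ab) bd.
Qed.

End Kleene.

(** * Tuples of variables and definable tuple relations *)

Section Tuples.
Variable T : Type.
Implicit Types (f : nat -> T) (xs : seq nat) (us : seq T).

Lemma updl_notin f xs us y : y \notin xs -> updl f xs us y = f y.
Proof.
elim: xs us f => [|x xs IH] [|u us] f //=.
by rewrite inE negb_or => /andP[yx /IH->]; apply: upd_other; apply/eqP.
Qed.

Lemma map_updl f xs us : uniq xs -> size us = size xs -> map (updl f xs us) xs = us.
Proof.
elim: xs us f => [|x xs IH] [|u us] f //= /andP[xxs uxs] [sz].
by rewrite updl_notin // upd_same IH.
Qed.

Lemma map_updl_disjoint f xs us ys :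
  (forall y, y \in ys -> y \notin xs) -> map (updl f xs us) ys = map f ys.
Proof. by move=> dis; apply/eq_in_map => y /dis; apply: updl_notin. Qed.

End Tuples.

Definition fresh (s : seq nat) (m : nat) : seq nat := iota (foldr maxn 0 s).+1 m.

Lemma size_fresh s m : size (fresh s m) = m.
Proof. exact: size_iota. Qed.

Lemma fresh_uniq s m : uniq (fresh s m).
Proof. exact: iota_uniq. Qed.

Lemma fresh_notin s m x : x \in s -> x \notin fresh s m.
Proof.
move=> xs; rewrite mem_iota negb_and -leqNgt; apply/orP; left.
elim: s xs => //= y s IH; rewrite inE => /orP[/eqP->|/IH]; by lia.
Qed.

Section Definable.
Variables (Sigma : finType) (Did Dprop : Type).
Implicit Type G : dgraph Sigma Did Dprop.

Fixpoint SExs (zs : seq nat) (phi : fos Sigma) : fos Sigma :=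
  if zs is z :: zs' then SEx z (SExs zs' phi) else phi.

Lemma SExs_wf zs phi : fos_wf (SExs zs phi) = fos_wf phi.
Proof. by elim: zs. Qed.

Lemma SExs_sat zs phi G (nu : nat -> V G) :
  fos_sat (SExs zs phi) nu <->
  exists2 us, size us = size zs & fos_sat phi (updl nu zs us).
Proof.
elim: zs nu => [|z zs IH] nu /=.
  by split=> [?|[[]//]]; exists [::].
split=> [[v /IH[us sz H]]|[[|v us] //= [sz] H]].
  by exists (v :: us); rewrite //= sz.
by exists v; apply/IH; exists us.
Qed.

Lemma SStar_sat xs ys phi G (nu : nat -> V G) :
  fos_sat (SStar xs ys phi) nu =
  clos_refl_trans_1n (seq (V G))
    (fun us us' => size us = size xs /\ size us' = size xs /\
                   fos_sat phi (updl (updl nu xs us) ys us'))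
    (map nu xs) (map nu ys).
Proof. by []. Qed.

Lemma SAnd_sat phi psi G (nu : nat -> V G) :
  fos_sat (SAnd phi psi) nu = (fos_sat phi nu /\ fos_sat psi nu).
Proof. by []. Qed.

Definition tuple_rel := forall G, seq (V G) -> seq (V G) -> Prop.

(** A formula scheme, usable at all variable tuples of the right length, overlapping or repetitive
    ones included, because composition and iteration reinstantiate it at new variables. *)
Definition defines (m : nat) (F : seq nat -> seq nat -> fos Sigma) (R : tuple_rel) :=
  forall xs ys, size xs = m -> size ys = m ->
    fos_wf (F xs ys) /\
    forall G (nu : nat -> V G), fos_sat (F xs ys) nu <-> R G (map nu xs) (map nu ys).

(** The length clause ensures that an intermediate tuple can be named by [m] quantified
    variables. *)
Definition definable m (R : tuple_rel) :=
  (exists F, defines m F R) /\ forall G u v, R G u v -> size u = m /\ size v = m.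

Lemma definable_ext m (R R' : tuple_rel) :
  (forall G u v, R G u v <-> R' G u v) -> definable m R -> definable m R'.
Proof.
move=> RR' [[F dF] sz]; split=> [|G u v /RR' /sz] //.
exists F => xs ys szx szy; have [wf sat] := dF xs ys szx szy.
by split=> // G nu; rewrite sat RR'.
Qed.

Lemma definable_or m (R R' : tuple_rel) : definable m R -> definable m R' ->
  definable m (fun G u v => R G u v \/ R' G u v).
Proof.
move=> [[F dF] sz] [[F' dF'] sz']; split=> [|G u v [/sz|/sz']] //.
exists (fun xs ys => SOr (F xs ys) (F' xs ys)) => xs ys szx szy.
have [wf sat] := dF xs ys szx szy; have [wf' sat'] := dF' xs ys szx szy.
by split=> [|G nu]; [rewrite /= wf wf' | rewrite SOr_sat sat sat'].
Qed.

Lemma definable_bigor m A (s : seq A) (R : A -> tuple_rel) :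
  (forall a, List.In a s -> definable m (R a)) ->
  definable m (fun G u v => exists2 a, List.In a s & R a G u v).
Proof.
elim: s => [_|a s IH dR].
  split=> [|G u v []] //.
  exists (fun _ _ => SNot (STrue Sigma)) => xs ys _ _; split=> // G nu /=.
  by split=> [/(_ erefl)|[]].
apply: definable_ext (definable_or (dR a (or_introl erefl)) (IH _)); last first.
  by move=> b sb; apply: dR; right.
move=> G u v; split=> [[H|[b sb H]]|[b [<-|sb] H]].
- by exists a => //; left.
- by exists b => //; right.
- by left.
- by right; exists b.
Qed.

Lemma definable_comp m (R R' : tuple_rel) : definable m R -> definable m R' ->
  definable m (fun G u v => exists w, R G u w /\ R' G w v).
Proof.
move=> [[F dF] sz] [[F' dF'] sz']; split; last first.
  by move=> G u v [w [/sz[? ?] /sz'[? ?]]].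
pose zs xs ys := fresh (xs ++ ys) m.
exists (fun xs ys => SExs (zs xs ys) (SAnd (F xs (zs xs ys)) (F' (zs xs ys) ys))).
move=> xs ys szx szy; have szz : size (zs xs ys) = m by rewrite size_fresh.
have [wf sat] := dF _ _ szx szz; have [wf' sat'] := dF' _ _ szz szy.
split=> [|G nu]; first by rewrite SExs_wf /= wf wf'.
rewrite SExs_sat.
have E w : size w = m ->
    (fos_sat (SAnd (F xs (zs xs ys)) (F' (zs xs ys) ys)) (updl nu (zs xs ys) w) <->
     R G (map nu xs) w /\ R' G w (map nu ys)).
  move=> szw; rewrite /= sat sat' map_updl ?fresh_uniq ?szz //.
  rewrite !map_updl_disjoint // => y iny; apply: fresh_notin;
    by rewrite mem_cat iny ?orbT.
split=> [[w]|[w [Rw R'w]]]; first by rewrite szz => szw /(E w szw); exists w.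
have [_ szw] := sz _ _ _ Rw; exists w; rewrite ?szz //.
by apply/E.
Qed.

Definition SEqs (xs ys : seq nat) : fos Sigma :=
  SBigAnd [seq SEq p.1 p.2 | p <- zip xs ys].

Lemma SEqs_wf xs ys : fos_wf (SEqs xs ys).
Proof. exact: SBigAnd_wf. Qed.

Lemma SEqs_sat xs ys G (nu : nat -> V G) : size xs = size ys ->
  fos_sat (SEqs xs ys) nu <-> map nu xs = map nu ys.
Proof.
rewrite SBigAnd_sat; elim: xs ys => [|x xs IH] [|y ys] //= [] /IH {}IH.
split=> [H|[Exy /IH H] p [<- //|]]; last exact: H.
congr (_ :: _); first by apply: (H (x, y)); left.
by apply/IH => p Hp; apply: H; right.
Qed.

Lemma definable_eq m : definable m (fun G u v => size u = m /\ u = v).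
Proof.
split=> [|G u v [<- <-]] //.
exists SEqs => xs ys szx szy; split=> [|G nu]; first exact: SEqs_wf.
by rewrite SEqs_sat ?szx // size_map; split=> [|[]].
Qed.

(** Iteration is treated only after a first factor: on its own it relates lists of every length to
    themselves, hence has no arity. Its endpoints go through the fresh tuples [zs] and [ws], since
    [xs] and [ys] may overlap or repeat variables, which [fos_wf] forbids under a star. *)
Lemma definable_comp_star m (R R' : tuple_rel) : definable m R -> definable m R' ->
  definable m (fun G u v =>
    exists2 w, R G u w & clos_refl_trans_1n (seq (V G)) (R' G) w v).
Proof.
move=> [[F dF] sz] dR'.
suff [F' dF'] : exists F', defines m F' (fun G u v =>
    exists w, R G u w /\ clos_refl_trans_1n (seq (V G)) (R' G) w v).
  split; last first.
    move=> G u v [w /sz[szu szw] wv]; split=> //.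
    by elim: wv szw => // a b c /(dR'.2)[_ szb] _ IH _; apply: IH.
  exists F' => xs ys szx szy; have [wf sat] := dF' xs ys szx szy; split=> // G nu.
  by rewrite sat; split=> [[w [Rw wv]]|[w Rw wv]]; exists w.
case: dR' => [[F' dF'] sz'].
pose zs xs ys := fresh (xs ++ ys) m; pose ws xs ys := fresh (xs ++ ys ++ zs xs ys) m.
exists (fun xs ys => SExs (zs xs ys) (SExs (ws xs ys)
  (SAnd (F xs (zs xs ys)) (SAnd (SEqs (ws xs ys) ys)
     (SStar (zs xs ys) (ws xs ys) (F' (zs xs ys) (ws xs ys))))))).
move=> xs ys szx szy.
have szz : size (zs xs ys) = m by rewrite size_fresh.
have szw : size (ws xs ys) = m by rewrite size_fresh.
have uz : uniq (zs xs ys) by exact: fresh_uniq.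
have uw : uniq (ws xs ys) by exact: fresh_uniq.
have xsz y : y \in xs -> y \notin zs xs ys.
  by move=> iny; apply: fresh_notin; rewrite mem_cat iny.
have ysz y : y \in ys -> y \notin zs xs ys.
  by move=> iny; apply: fresh_notin; rewrite mem_cat iny orbT.
have xsw y : y \in xs -> y \notin ws xs ys.
  by move=> iny; apply: fresh_notin; rewrite mem_cat iny.
have ysw y : y \in ys -> y \notin ws xs ys.
  by move=> iny; apply: fresh_notin; rewrite !mem_cat iny orbT.
have zsw y : y \in zs xs ys -> y \notin ws xs ys.
  by move=> iny; apply: fresh_notin; rewrite !mem_cat iny !orbT.
move: (zs xs ys) (ws xs ys) => {}zs {}ws in szz szw uz uw xsz ysz xsw ysw zsw *.
have [wf sat] := dF _ _ szx szz; have [wf' sat'] := dF' _ _ szz szw.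
split.
  rewrite !SExs_wf /= wf wf' szz szw eqxx SEqs_wf //= cat_uniq uz uw !andbT /=.
  by apply/hasPn => y yw; apply: contraL yw => /zsw.
move=> G nu; rewrite SExs_sat.
have eqs (nu' : nat -> V G) : fos_sat (SEqs ws ys) nu' <-> map nu' ws = map nu' ys.
  by apply: SEqs_sat; rewrite szw.
have star (nu' : nat -> V G) : fos_sat (SStar zs ws (F' zs ws)) nu' <->
    clos_refl_trans_1n (seq (V G)) (R' G) (map nu' zs) (map nu' ws).
  rewrite SStar_sat; split; apply: rt1n_mono => u v.
    move=> [szu [szv]]; rewrite sat' map_updl ?szw //; last by rewrite szv szz.
    by rewrite map_updl_disjoint // map_updl.
  move=> R'uv; have [szu szv] := sz' _ _ _ R'uv; rewrite szz; split=> //; split=> //.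
  rewrite sat' map_updl ?szw // map_updl_disjoint // map_updl //.
  by rewrite szu szz.
split=> [[u szu /SExs_sat[v szv [/sat H [/eqs Evy /star H']]]]|[u [Ru R'u]]].
  move: H Evy H'; rewrite !(map_updl_disjoint _ _ xsw) !(map_updl_disjoint _ _ ysw).
  rewrite !(map_updl_disjoint _ _ xsz) !(map_updl_disjoint _ _ ysz).
  rewrite !(map_updl_disjoint _ _ zsw) !map_updl // => H -> H'.
  by exists u.
have [_ szu] := sz _ _ _ Ru; exists u; first by rewrite szz.
apply/SExs_sat; exists (map nu ys); first by rewrite size_map szw.
rewrite !SAnd_sat sat eqs star.
rewrite !(map_updl_disjoint _ _ xsw) !(map_updl_disjoint _ _ ysw).
rewrite !(map_updl_disjoint _ _ xsz) !(map_updl_disjoint _ _ ysz).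
rewrite !(map_updl_disjoint _ _ zsw) !map_updl //; last by rewrite szu szz.
by rewrite size_map szw.
Qed.

Lemma definable_kleene m I (r : I -> I -> tuple_rel) l i j :
  (forall i j, definable m (r i j)) ->
  definable m (fun G => kleene (fun i j => r i j G) l i j).
Proof.
move=> dr; elim: l i j => [|k l IH] i j /=; first exact: dr.
apply: definable_or => //; apply: definable_comp => //.
exact: definable_comp_star.
Qed.

End Definable.

(** * RDPQ in FO* *)

Section OptionEq.
Variables (Sigma : finType) (Did Dprop : Type).
Implicit Type G : dgraph Sigma Did Dprop.

Definition SOptEq (at_eq : nat -> nat -> fos Sigma) (o o' : option nat) : fos Sigma :=
  match o, o' with
  | Some x, Some y => at_eq x y
  | None, None => STrue Sigma
  | _, _ => SNot (STrue Sigma)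
  end.

Lemma SOptEq_wf at_eq o o' : (forall x y, fos_wf (at_eq x y)) ->
  fos_wf (SOptEq at_eq o o').
Proof. by case: o o' => [x|] [y|] /=. Qed.

Lemma SOptEq_sat B at_eq G (f : V G -> B) (nu : nat -> V G) o o' :
  (forall x y, fos_sat (at_eq x y) nu <-> f (nu x) = f (nu y)) ->
  fos_sat (SOptEq at_eq o o') nu <-> omap f (omap nu o) = omap f (omap nu o').
Proof.
move=> sat; case: o o' => [x|] [y|] //=; [|by split=> // /(_ erefl)..].
by rewrite sat; split=> [->|[]].
Qed.

End OptionEq.

(* A configuration of a unary RDPA is a state, a set of defined registers, and a
   node tuple: the current node, then for each register some node carrying its
   value (arbitrary for undefined registers). *)
Section RunRelation.
Variables (Sigma : finType) (Did Dprop : Type) (A : rdpa Sigma 1).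
Implicit Type G : dgraph Sigma Did Dprop.

Definition reg_flags := ({ffun 'I_(nid A) -> bool} * {ffun 'I_(ndat A) -> bool})%type.
Definition run_state : finType := (Qd A * reg_flags)%type.
Definition run_arity := (nid A + ndat A).+1.

(** Polymorphic in [X] so that one lookup serves node tuples in the semantics and variable tuples in
    formulas; [idcell_map] connects the two. *)
Definition idcell X (f : reg_flags) (u : seq X) (t : idterm 1 (nid A)) : option X :=
  match t with
  | IdReg r => if f.1 r then onth u r.+1 else None
  | IdIn _ => onth u 0
  | IdSharp => None
  end.
Definition dcell X (f : reg_flags) (u : seq X) (t : dterm 1 (ndat A)) : option X :=
  match t with
  | DReg r => if f.2 r then onth u (nid A + r).+1 else None
  | DIn _ => onth u 0
  | DSharp => None
  end.

Lemma idcell_map X Y (h : X -> Y) f u t : idcell f (map h u) t = omap h (idcell f u t).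
Proof. by case: t => [r|?|] //; rewrite /idcell onth_map //; case: ifP. Qed.

Lemma dcell_map X Y (h : X -> Y) f u t : dcell f (map h u) t = omap h (dcell f u t).
Proof. by case: t => [r|?|] //; rewrite /dcell onth_map //; case: ifP. Qed.

Definition decode G (f : reg_flags) (u : seq (V G)) : regs Did Dprop A :=
  (fun r => omap (@gid _ _ _ G) (idcell f u (IdReg 1 r)),
   fun r => omap (@dataof _ _ _ G) (dcell f u (DReg 1 r))).

Lemma eval_id_decode G f (u : seq (V G)) v t : onth u 0 = Some v ->
  eval_id (decode f u) (node_letter v) t = omap (@gid _ _ _ G) (idcell f u t).
Proof. by case: t => //= _ ->. Qed.

Lemma eval_d_decode G f (u : seq (V G)) v t : onth u 0 = Some v ->
  eval_d (decode f u) (node_letter v) t = omap (@dataof _ _ _ G) (dcell f u t).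
Proof. by case: t => //= _ ->. Qed.

Definition cell_atom G (f : reg_flags) (u : seq (V G)) (a : gatom 1 (nid A) (ndat A)) :=
  match a with
  | AIdEq t t' => omap (@gid _ _ _ G) (idcell f u t) = omap (@gid _ _ _ G) (idcell f u t')
  | AIdNeq t t' => omap (@gid _ _ _ G) (idcell f u t) <> omap (@gid _ _ _ G) (idcell f u t')
  | ADEq t t' => omap (@dataof _ _ _ G) (dcell f u t) = omap (@dataof _ _ _ G) (dcell f u t')
  | ADNeq t t' => omap (@dataof _ _ _ G) (dcell f u t) <> omap (@dataof _ _ _ G) (dcell f u t')
  end.

Lemma cell_atomE G f (u : seq (V G)) v a : onth u 0 = Some v ->
  atom_holds (decode f u) (node_letter v) a <-> cell_atom f u a.
Proof.
by move=> uv; case: a => t t' /=; rewrite ?(eval_id_decode _ _ uv) ?(eval_d_decode _ _ uv).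
Qed.

Definition SIdEq := SOptEq (@SEq Sigma).
Definition SDatEq := SOptEq (@SData Sigma).

Definition SAtom (f : reg_flags) (xs : seq nat) (a : gatom 1 (nid A) (ndat A)) : fos Sigma :=
  match a with
  | AIdEq t t' => SIdEq (idcell f xs t) (idcell f xs t')
  | AIdNeq t t' => SNot (SIdEq (idcell f xs t) (idcell f xs t'))
  | ADEq t t' => SDatEq (dcell f xs t) (dcell f xs t')
  | ADNeq t t' => SNot (SDatEq (dcell f xs t) (dcell f xs t'))
  end.

Lemma SIdEq_sat o o' G (nu : nat -> V G) : fos_sat (SIdEq o o') nu <->
  omap (@gid _ _ _ G) (omap nu o) = omap (@gid _ _ _ G) (omap nu o').
Proof. by apply: SOptEq_sat => x y; split=> [/= ->|/gid_inj]. Qed.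

Lemma SDatEq_sat o o' G (nu : nat -> V G) : fos_sat (SDatEq o o') nu <->
  omap (@dataof _ _ _ G) (omap nu o) = omap (@dataof _ _ _ G) (omap nu o').
Proof. exact: SOptEq_sat. Qed.

Lemma SAtom_wf f xs a : fos_wf (SAtom f xs a).
Proof. by case: a => t t'; apply: SOptEq_wf. Qed.

Lemma SAtom_sat f xs a G (nu : nat -> V G) :
  fos_sat (SAtom f xs a) nu <-> cell_atom f (map nu xs) a.
Proof.
case: a => t t'; rewrite [cell_atom _ _ _]/= ?idcell_map ?dcell_map;
  by [exact: SIdEq_sat | exact: SDatEq_sat | rewrite -SIdEq_sat | rewrite -SDatEq_sat].
Qed.

Definition new_id X f (u : seq X) (up : update 1 (nid A) (ndat A)) r : option X :=
  idcell f u (if upd_id up r is Some t then t else IdReg 1 r).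
Definition new_dat X f (u : seq X) (up : update 1 (nid A) (ndat A)) r : option X :=
  dcell f u (if upd_dat up r is Some t then t else DReg 1 r).

Lemma do_update_decode G f (u : seq (V G)) v up : onth u 0 = Some v ->
  do_update (decode f u) (node_letter v) up =
  (fun r => omap (@gid _ _ _ G) (new_id f u up r),
   fun r => omap (@dataof _ _ _ G) (new_dat f u up r)).
Proof.
move=> uv; congr (_, _); apply: functional_extensionality => r.
  by rewrite /new_id; case: (upd_id up r) => // t; apply: eval_id_decode.
by rewrite /new_dat; case: (upd_dat up r) => // t; apply: eval_d_decode.
Qed.

(** One step consumes the data letter of the current node and the word letter after it. Registers of
    [u'] are constrained only through ids and data values, so any carrier node will do, and the same
    equations force the flags of [j]. *)
Definition run_trans (tr : Qd A * seq (gatom 1 (nid A) (ndat A)) * update 1 (nid A) (ndat A) * Qw A)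
    (i j : run_state) : tuple_rel Sigma Did Dprop := fun G u u' =>
  (size u = run_arity /\ size u' = run_arity) /\
  [/\ tr.1.1.1 = i.1, forall a, List.In a tr.1.1.2 -> cell_atom i.2 u a,
    forall r, omap (@gid _ _ _ G) (idcell j.2 u' (IdReg 1 r)) =
              omap (@gid _ _ _ G) (new_id i.2 u tr.1.2 r),
    forall r, omap (@dataof _ _ _ G) (dcell j.2 u' (DReg 1 r)) =
              omap (@dataof _ _ _ G) (new_dat i.2 u tr.1.2 r) &
    exists a v v', [/\ wtrans tr.2 [ffun=> Some a] j.1,
      onth u 0 = Some v, onth u' 0 = Some v' & E v a v']].

Lemma definable_run_trans tr i j : definable run_arity (run_trans tr i j).
Proof.
split=> [|G u v []] //.
(* Conditions on control states alone are decided while the formula is built: they select a trivial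
   formula or filter the labels. *)
exists (fun xs ys =>
  SAnd (if tr.1.1.1 == i.1 then STrue Sigma else SNot (STrue Sigma))
  (SAnd (SBigAnd (map (SAtom i.2 xs) tr.1.1.2))
  (SAnd (SBigAnd [seq SIdEq (idcell j.2 ys (IdReg 1 r)) (new_id i.2 xs tr.1.2 r)
          | r <- enum 'I_(nid A)])
  (SAnd (SBigAnd [seq SDatEq (dcell j.2 ys (DReg 1 r)) (new_dat i.2 xs tr.1.2 r)
          | r <- enum 'I_(ndat A)])
  (SBigOr [seq SE a (nth 0 xs 0) (nth 0 ys 0)
          | a <- enum Sigma & wtrans tr.2 [ffun=> Some a] j.1]))))).
move=> xs ys szx szy; split.
  rewrite /= !SBigAnd_wf ?SBigOr_wf ?andbT //=; try by case: eqP.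
  - by move=> r _; apply: SOptEq_wf.
  - by move=> r _; apply: SOptEq_wf.
  - by move=> a _; apply: SAtom_wf.
move=> G nu; rewrite !SAnd_sat !SBigAnd_sat SBigOr_sat /run_trans !size_map.
have -> : fos_sat (if tr.1.1.1 == i.1 then STrue Sigma else SNot (STrue Sigma)) nu <->
  tr.1.1.1 = i.1 by case: eqP => //= ?; split=> // /(_ erefl).
have rE k (r : 'I_k) : List.In r (enum 'I_k) by apply/InP; rewrite mem_enum.
split.
  case=> H1 [H2 [H3 [H4 [a Ha H5]]]]; split=> //; split=> //.
  - by move=> b /H2; rewrite SAtom_sat.
  - by move=> r; have := H3 r (rE _ r); rewrite SIdEq_sat /new_id !idcell_map.
  - by move=> r; have := H4 r (rE _ r); rewrite SDatEq_sat /new_dat !dcell_map.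
  - move: Ha => /InP; rewrite mem_filter => /andP[Ha _].
    exists a, (nu (nth 0 xs 0)), (nu (nth 0 ys 0)); split=> //.
    + by case: (xs) szx.
    + by case: (ys) szy.
case=> _ [H1 H2 H3 H4 [a [v [v' [H5 H6 H7 H8]]]]]; split=> //; split.
  by move=> b /H2; rewrite SAtom_sat.
split; first by move=> r _; rewrite SIdEq_sat; have := H3 r; rewrite /new_id !idcell_map.
split; first by move=> r _; rewrite SDatEq_sat; have := H4 r; rewrite /new_dat !dcell_map.
exists a; first by apply/InP; rewrite mem_filter H5 mem_enum.
by case: (xs) (ys) H6 H7 => [|x ?] [|y ?] //= [->] [->].
Qed.

Definition run_step (i j : run_state) : tuple_rel Sigma Did Dprop := fun G u u' =>
  exists2 tr, List.In tr (dtrans A) & run_trans tr i j u u'.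

(** The last data letter is read without following an edge; keeping the tuple makes the current node
    of the result the end of the path. *)
Definition run_final (tr : Qd A * seq (gatom 1 (nid A) (ndat A)) * update 1 (nid A) (ndat A) * Qw A)
    (i : run_state) : tuple_rel Sigma Did Dprop := fun G u u' =>
  (size u = run_arity /\ u = u') /\
  [/\ tr.1.1.1 = i.1, forall a, List.In a tr.1.1.2 -> cell_atom i.2 u a & @qfin _ _ A tr.2].

Lemma definable_run_final tr i : definable run_arity (run_final tr i).
Proof.
split=> [|G u v [[<- <-]]] //.
exists (fun xs ys => SAnd (SEqs Sigma xs ys) (SAnd
  (if (tr.1.1.1 == i.1) && @qfin _ _ A tr.2 then STrue Sigma else SNot (STrue Sigma))
  (SBigAnd (map (SAtom i.2 xs) tr.1.1.2)))).
move=> xs ys szx szy; split.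
  rewrite /= SEqs_wf SBigAnd_wf ?andbT /=; first by case: ifP.
  by move=> a _; apply: SAtom_wf.
move=> G nu; rewrite !SAnd_sat SBigAnd_sat SEqs_sat ?szx // /run_final size_map.
have -> : fos_sat (if (tr.1.1.1 == i.1) && @qfin _ _ A tr.2
                   then STrue Sigma else SNot (STrue Sigma)) nu <->
  tr.1.1.1 = i.1 /\ @qfin _ _ A tr.2.
  case: ifP => [/andP[/eqP e q]|/negbT ne]; first by split.
  by split=> [/(_ erefl)|[/eqP e q]] //; move: ne; rewrite e q.
split=> [[H1 [[H2 H3] H4]]|[[_ H1] [H2 H4 H3]]].
  by split=> //; split=> // a /H4; rewrite SAtom_sat.
by split=> //; split=> // a /H4; rewrite SAtom_sat.
Qed.

Definition run_init : run_state := (q0 A, ([ffun=> false], [ffun=> false])).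

Definition run_accept : tuple_rel Sigma Did Dprop := fun G u u' =>
  exists2 j, List.In j (enum run_state) &
  exists w,
    ((size u = run_arity /\ u = w) /\ run_init = j \/
     kleene (fun i j => run_step i j (G := G)) (enum run_state) run_init j u w) /\
    exists2 tr, List.In tr (dtrans A) & run_final tr j w u'.

Lemma definable_run_accept : definable run_arity run_accept.
Proof.
apply: definable_bigor => j _; apply: definable_comp; last first.
  by apply: definable_bigor => tr _; apply: definable_run_final.
apply: definable_or; last first.
  apply: definable_kleene => i k; apply: definable_bigor => tr _.
  exact: definable_run_trans.
have [[F dF] sz] := definable_eq Sigma Did Dprop run_arity.
split=> [|G u v [/sz]] //; case: (eqVneq run_init j) => [->|ne].
  by exists F => xs ys szx szy; have [wf sat] := dF xs ys szx szy; split=> // G nu;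
    rewrite sat; split=> [|[]].
exists (fun _ _ => SNot (STrue Sigma)) => xs ys _ _; split=> // G nu /=.
by split=> [/(_ erefl)|[_ /eqP]] //; rewrite (negPf ne).
Qed.

Lemma run_acceptE G (u u' : seq (V G)) : run_accept u u' <->
  size u = run_arity /\
  exists2 c, steps (fun i j => run_step i j (G := G)) (run_init, u) c &
    exists2 tr, List.In tr (dtrans A) & run_final tr c.1 c.2 u'.
Proof.
have full k : List.In k (enum run_state) by apply/InP; rewrite mem_enum.
split=> [[j _ [w [[[[szu <-] <-]|K] fin]]]|[szu [[j w] /(steps_kleene full)[]]]].
- by split=> //; exists (run_init, u); first by left.
- split; last by exists (j, w) => //; apply: kleene_steps K.
  (* Only the arity part of definability is used here, to recover the size of [u]. *)
  have [_] := definable_kleene (enum run_state) run_init j (fun i k => definable_bigor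
    (fun tr (_ : List.In tr (dtrans A)) => definable_run_trans tr i k)).
  by move=> /(_ _ _ _ K)[].
- by case=> <- <- fin; exists run_init => //; exists u; split=> //; left.
- by move=> /= K fin; exists j => //; exists w; split=> //; right.
Qed.

Lemma run_final_accepts G (u u' : seq (V G)) i tr :
  List.In tr (dtrans A) -> run_final tr i u u' ->
  exists2 v, onth u 0 = Some v &
    u = u' /\ acc_from i.1 (decode i.2 u) (node_letter v) [::].
Proof.
move=> intr [[szu <-] [Eq guard fin]].
case: u szu guard => [|v us] // _ guard; exists v => //; split=> //.
case: tr intr Eq guard fin => [[[q g] up] p] /= intr <- guard fin.
exists g, up, p; split=> //; split=> // a /guard.
by rewrite -(cell_atomE _ _ (erefl : onth (v :: us) 0 = Some v)).
Qed.

Lemma run_step_decode G (u u' : seq (V G)) v i j tr :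
  onth u 0 = Some v -> run_trans tr i j u u' ->
  do_update (decode i.2 u) (node_letter v) tr.1.2 = decode j.2 u'.
Proof.
move=> uv [_ [_ _ Hid Hd _]]; rewrite (do_update_decode _ _ uv).
by congr (_, _); apply: functional_extensionality => r; rewrite ?Hid ?Hd.
Qed.

(** The path is recovered from the run: its nodes are the current nodes of the successive tuples,
    its labels the word letters of the steps. *)
Lemma run_sound G c c' tr (u' : seq (V G)) :
  steps (fun i j => run_step i j (G := G)) c c' ->
  List.In tr (dtrans A) -> run_final tr c'.1 c'.2 u' ->
  exists v t, [/\ onth c.2 0 = Some v, valid_steps v t,
    acc_from c.1.1 (decode c.1.2 c.2) (node_letter v) (step_letters t) &
    onth u' 0 = Some (last v (map snd t))].
Proof.
move=> cc' intr fin.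
elim: cc' fin => [{}c|{}c d {}c' step _ IH] fin.
  have [v cv [<- acc]] := run_final_accepts intr fin.
  by exists v, [::].
have [v' [t [dv' valid acc last_v']]] := IH fin.
case: step => tr' intr' step.
have [_ [Eq guard _ _ [a [v [v'' [wt cv dv'' Evv]]]]]] := step.
move: dv'' Evv; rewrite dv' => -[<-] Evv.
exists v, ((a, v') :: t); split=> //=; first by rewrite Evv.
exists tr'.1.1.2, tr'.1.2, tr'.2; split.
  by case: (tr') intr' Eq => [[[q g] up] p] /= ? <-.
split; first by move=> b /guard; rewrite -(cell_atomE _ _ cv).
by exists d.1.1; split=> //; rewrite (run_step_decode cv step).
Qed.

Definition next_flags X (f : reg_flags) (u : seq X) up : reg_flags :=
  ([ffun r => isSome (new_id f u up r)], [ffun r => isSome (new_dat f u up r)]).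
(** Undefined registers are filled with the new node, an arbitrary choice because their flags are
    off. *)
Definition next_tuple X (f : reg_flags) (u : seq X) up (v : X) : seq X :=
  v :: [seq odflt v (new_id f u up r) | r <- enum 'I_(nid A)] ++
       [seq odflt v (new_dat f u up r) | r <- enum 'I_(ndat A)].

Lemma onth_map_enum X k (h : 'I_k -> X) (r : 'I_k) :
  onth [seq h i | i <- enum 'I_k] r = Some (h r).
Proof.
by rewrite onth_map onthE (nth_map r) ?size_enum_ord // nth_ord_enum.
Qed.

Lemma next_id X f (u : seq X) up v r :
  idcell (next_flags f u up) (next_tuple f u up v) (IdReg 1 r) = new_id f u up r.
Proof.
rewrite /= ffunE; case E: (new_id f u up r) => [w|] //=.
rewrite onth_cat size_map size_enum_ord ltn_ord.
by rewrite onth_map_enum E.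
Qed.

Lemma next_dat X f (u : seq X) up v r :
  dcell (next_flags f u up) (next_tuple f u up v) (DReg 1 r) = new_dat f u up r.
Proof.
rewrite /= ffunE; case E: (new_dat f u up r) => [w|] //=.
rewrite onth_cat size_map size_enum_ord ltnNge leq_addr /= addKn.
by rewrite onth_map_enum E.
Qed.

Lemma run_complete G t q f (u : seq (V G)) v :
  size u = run_arity -> onth u 0 = Some v -> valid_steps v t ->
  acc_from q (decode f u) (node_letter v) (step_letters t) ->
  exists c u' tr, [/\ steps (fun i j => run_step i j (G := G)) ((q, f), u) c,
    List.In tr (dtrans A), run_final tr c.1 c.2 u' &
    onth u' 0 = Some (last v (map snd t))].
Proof.
elim: t q f u v => [|[a v'] t IH] q f u v szu uv /=.
  move=> _ [g [up [p [intr [guard fin]]]]].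
  exists ((q, f), u), u, (q, g, up, p); split=> //; first by left.
  by split=> //; split=> // b /guard; rewrite (cell_atomE _ _ uv).
move=> /andP[Evv valid] [g [up [p [intr [guard [q' [wt acc]]]]]]].
pose f' := next_flags f u up; pose u' := next_tuple f u up v'.
have szu' : size u' = run_arity by rewrite /= size_cat 2!size_map 2!size_enum_ord.
have step : run_trans (q, g, up, p) (q, f) (q', f') u u'.
  split=> //; split=> // [b /guard|r|r|].
  - by rewrite (cell_atomE _ _ uv).
  - by rewrite next_id.
  - by rewrite next_dat.
  - by exists a, v, v'.
have [|c [u'' [tr [st intr' fin lst]]]] := IH q' f' u' v' szu' erefl valid.
  by rewrite -(run_step_decode uv step).
exists c, u'', tr; split=> //; right with ((q', f'), u') => //.
by exists (q, g, up, p).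
Qed.

End RunRelation.

Lemma RDPQ_FOStar (Sigma : finType) (Did Dprop : Type) :
  subsumed (RDPQ Sigma Did Dprop) (FOStar Sigma Did Dprop).
Proof.
case=> [[x y] A].
have [[F dF] _] := definable_run_accept Did Dprop A.
have [zs [szz uz xyz]] : exists zs, [/\ size zs = run_arity A, uniq zs &
    forall i, i \in [:: x; y] -> i \notin zs].
  exists (fresh [:: x; y] (run_arity A)).
  by rewrite size_fresh fresh_uniq; split=> // i; apply: fresh_notin.
have [ws [szw uw xyzw]] : exists ws, [/\ size ws = run_arity A, uniq ws &
    forall i, i \in [:: x, y & zs] -> i \notin ws].
  exists (fresh [:: x, y & zs] (run_arity A)).
  by rewrite size_fresh fresh_uniq; split=> // i; apply: fresh_notin.
pose psi := SExs zs (SExs ws (SAnd (SEq x (nth 0 zs 0))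
  (SAnd (SEq y (nth 0 ws 0)) (F zs ws)))).
have [wf sat] := dF zs ws szz szw.
have wf_psi : fos_wf psi by rewrite !SExs_wf /= wf.
exists (exist _ psi wf_psi) => G nu _ /=.
have zsw i : i \in zs -> i \notin ws.
  by move=> iz; apply: xyzw; rewrite !inE iz !orbT.
have [xz yz] : x \notin zs /\ y \notin zs by rewrite !xyz // !inE eqxx ?orbT.
have [xw yw] : x \notin ws /\ y \notin ws by rewrite !xyzw // !inE eqxx ?orbT.
have psiE : fos_sat psi nu <-> exists u u', [/\ onth u 0 = Some (nu x),
    onth u' 0 = Some (nu y) & run_accept A u u'].
  have eqE i j (nu' : nat -> V G) : fos_sat (SEq i j) nu' = (nu' i = nu' j) by [].
  have E u u' : size u = run_arity A -> size u' = run_arity A ->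
    fos_sat (SAnd (SEq x (nth 0 zs 0)) (SAnd (SEq y (nth 0 ws 0)) (F zs ws)))
      (updl (updl nu zs u) ws u') <->
    [/\ onth u 0 = Some (nu x), onth u' 0 = Some (nu y) & run_accept A u u'].
    move=> szu szu'; rewrite !SAnd_sat sat.
    rewrite (map_updl_disjoint _ _ zsw) !map_updl ?szz ?szw // !eqE.
    set nu' := updl _ ws u'.
    have -> : nu' x = nu x by rewrite /nu' !updl_notin.
    have -> : nu' y = nu y by rewrite /nu' !updl_notin.
    have z0 : onth u 0 = Some (nu' (nth 0 zs 0)).
      rewrite -{1}(map_updl nu uz (etrans szu (esym szz))).
      rewrite -(map_updl_disjoint _ u' zsw) -/nu'.
      by case: (zs) szz.
    have w0 : onth u' 0 = Some (nu' (nth 0 ws 0)).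
      rewrite -{1}(map_updl (updl nu zs u) uw (etrans szu' (esym szw))) -/nu'.
      by case: (ws) szw.
    rewrite z0 w0; split=> [[-> [-> ?]]|[[->] [->] ?]] //.
  rewrite SExs_sat; split=> [[u szu /SExs_sat[u' szu' H]]|[u [u' H]]].
    by exists u, u'; apply/E; rewrite ?szu ?szu'.
  have [_ _ acc] := H.
  have [szu szu'] := (definable_run_accept Did Dprop A).2 _ _ _ acc.
  exists u; rewrite ?szz //; apply/SExs_sat; exists u'; rewrite ?szw //.
  exact/E.
have init (u : seq (V G)) : decode (run_init A).2 u = (fun _ => None, fun _ => None).
  by congr (_, _); apply: functional_extensionality => r /=; rewrite ffunE.
rewrite psiE; split.
  case=> [[[v t] valid]] [] Ev [lst]; move: Ev lst; rewrite /pfirst /plast /= => Ev lst acc.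
  move: valid acc; rewrite convolution_unary /rdpa_accepts /= => valid acc; subst v.
  (* All registers start undefined, so only the first entry matters and the others are padding. *)
  pose u := nseq (run_arity A) (nu x).
  have [||||c [u' [tr [st intr fin lst']]]] :=
    @run_complete _ _ _ A G t (q0 A) (run_init A).2 u (nu x).
  - by rewrite size_nseq.
  - by [].
  - by [].
  - by rewrite init.
  exists u, u'; split; [by [] | by move: lst'; rewrite lst | ].
  by apply/run_acceptE; split; [rewrite size_nseq|]=> //; exists c => //; exists tr.
case=> u [u' [ux uy /run_acceptE[_ [c st [tr intr fin]]]]].
have [v [t [uv valid acc lst]]] := run_sound st intr fin.
exists (exist _ (v, t) valid); rewrite /pfirst /plast /=.
move: ux uy; rewrite uv lst => -[<-] [<-]; split=> //; split=> //.
by rewrite convolution_unary /rdpa_accepts /= -(init u).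
Qed.

(** * Local automata on pairs of paths *)

Section LocalAutomata.
Variables (Sigma : finType) (Did Dprop : Type).
Implicit Type G : dgraph Sigma Did Dprop.

(** With one state of each kind and no register, acceptance is a conjunction of conditions on single
    positions. *)
Definition local_rdpa n (gs : seq (seq (gatom n 0 0)))
    (W : pred {ffun 'I_n -> option Sigma}) : rdpa Sigma n :=
  @RDPA Sigma n unit unit tt predT 0 0 (fun _ w _ => W w)
    [seq (tt, g, Update (fun _ => None) (fun _ => None), tt) | g <- gs].

Definition letter_ok n gs W (d : dletter Did Dprop n) :=
  exists2 g, List.In g gs & forall a, List.In a g ->
    atom_holds (A := @local_rdpa n gs W) (fun _ => None, fun _ => None) d a.

Lemma local_rdpa_accepts n gs W G (ps : 'I_n -> rawpath G) :
  let L := \max_(i < n) plen (ps i) in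
  rdpa_accepts (local_rdpa gs W) (convolution ps) <->
  (forall j, j <= L -> letter_ok gs W (conv_dletter ps j)) /\
  (forall j, j < L -> W (conv_wletter ps j.+1)).
Proof.
move=> L; rewrite /rdpa_accepts /convolution -/L /=.
have acc d rest : acc_from (A := local_rdpa gs W) tt (fun _ => None, fun _ => None) d rest <->
    letter_ok gs W d /\ forall x, List.In x rest -> W x.1 /\ letter_ok gs W x.2.
  elim: rest d => [|[w d'] rest IH] d /=.
    split=> [[g [u [q [inq [H _]]]]]|[[g ing H] _]].
      move: inq => /In_map[g1 ing [Eg _ _]]; subst g; by split=> //; exists g1.
    exists g, (Update (fun _ => None) (fun _ => None)), tt; split=> //.
    by apply/In_map; exists g.
  split=> [[g [u [q [inq [H [q'' [Ww acc]]]]]]]|[[g ing H] okr]].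
    move: inq acc => /In_map[g' ing [Eg -> _]]; subst g; case: q'' Ww => Ww /IH[ok okr].
    by split=> [|x [<- //|/okr //]]; exists g'.
  exists g, (Update (fun _ => None) (fun _ => None)), tt; split.
    by apply/In_map; exists g.
  split=> //; exists tt; have [/= Ww ok] := okr _ (or_introl erefl).
  by split=> //; apply/IH; split=> // x inx; apply: okr; right.
rewrite acc; split=> [[ok0 okr]|[okd okw]].
  have okS j : j < L -> W (conv_wletter ps j.+1) /\ letter_ok gs W (conv_dletter ps j.+1).
    move=> jL; apply: (okr (conv_wletter ps j.+1, conv_dletter ps j.+1)).
    apply/In_map; exists j.+1 => //; apply/InP; rewrite mem_iota; lia.
  by split=> [[|j] jL|j /okS[]] //; case: (okS j jL).
split=> [|_ /In_map[j /InP jL ->]]; first exact: okd.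
move: jL; rewrite mem_iota; case: j => [|j] //= jL.
by split; [apply: okw | apply: okd]; lia.
Qed.

Definition pair_fun X (p q : X) (i : 'I_2) : X := if i == ord0 then p else q.

Definition in0 k : idterm 2 k := IdIn k ord0.
Definition in1 k : idterm 2 k := IdIn k ord_max.

(** Taking [predT] for [S] gives the prefix order; [pred1 a] is what a step labelled [a]
    requires. *)
Definition is_ext G (S : pred Sigma) (r r' : rawpath G) :=
  r.1 = r'.1 /\ exists2 t, r'.2 = r.2 ++ t & all (fun e => S e.1) t.

Definition FLocal gs W p q : foe Sigma := FIn (local_rdpa gs W) (pair_fun p q).

Lemma FLocal_sat gs W p q G (nu : nat -> V G) eta :
  let ps := pair_fun (proj1_sig (eta p)) (proj1_sig (eta q)) in
  let L := maxn (plen (proj1_sig (eta p))) (plen (proj1_sig (eta q))) in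
  foe_sat (FLocal gs W p q) nu eta <->
  (forall j, j <= L -> letter_ok gs W (conv_dletter ps j)) /\
  (forall j, j < L -> W (conv_wletter ps j.+1)).
Proof.
move=> ps L; rewrite /=.
have -> : (fun i => proj1_sig (eta (pair_fun p q i))) = ps.
  by apply: functional_extensionality => i; rewrite /ps /pair_fun; case: ifP.
by rewrite local_rdpa_accepts !big_ord_recl big_ord0 maxn0.
Qed.

Lemma posnode_isSome G (r : rawpath G) j :
  (j <= plen r) = isSome (posnode r j).
Proof.
by case: j => [|j]; rewrite /= ?leq0n // /plen -onthTE; case: (onth r.2 j).
Qed.

(** The right-hand side speaks of one position at a time, with nodes and labels apart, because data
    letters and word letters are checked separately. *)
Lemma onth_ext (T : Type) (S : pred Sigma) (s s' : seq (Sigma * T)) :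
  (exists2 t, s' = s ++ t & all (fun e => S e.1) t) <->
  forall j, j < maxn (size s) (size s') ->
    (omap snd (onth s j) = omap snd (onth s' j) \/ onth s j = None) /\
    (omap fst (onth s j) = omap fst (onth s' j) \/
     onth s j = None /\ exists2 b, omap fst (onth s' j) = Some b & S b).
Proof.
elim: s s' => [|e s IH] s' /=.
  rewrite max0n; split=> [[t -> allS] j|H].
    move=> lt; rewrite onth0n; split; [by right | right; split=> //].
    elim: t j allS lt => [|[a v] t IH] [|j] //= /andP[Sa allS] lt; first by exists a.
    exact: IH.
  exists s' => //; elim: s' H => //= [[a v] s' IH] H; apply/andP; split.
    by have [_ [|[_ [b [<-]]]]] := H 0 isT.
  by apply: IH => j jlt; have := H j.+1 jlt; rewrite !onth0n.
case: s' => [|e' s'] /=.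
  split=> [[t] //|H].
  by have [[|]] := H 0 isT.
rewrite maxnSS; split=> [[t [<- Es'] allS] [|j] lt|H].
- by split; left.
- by apply: (iffLR (IH s')) => //; exists t.
have [[|//] [Ev] [|[//]] [Ea]] := H 0 isT.
have [|t -> allS] := iffRL (IH s'); first by move=> j jlt; apply: (H j.+1).
by exists t => //; rewrite [e]surjective_pairing [e']surjective_pairing Ea Ev.
Qed.

Definition ext_guards : seq (seq (gatom 2 0 0)) :=
  [:: [:: AIdEq 0 (in0 0) (in1 0)]; [:: AIdEq 0 (in0 0) (IdSharp 2 0)]].
Definition ext_labels (S : pred Sigma) : pred {ffun 'I_2 -> option Sigma} :=
  fun w => (w ord0 == w ord_max) ||
           (w ord0 == None) && (if w ord_max is Some b then S b else false).

Definition FExt S p q := FLocal ext_guards (ext_labels S) p q.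

Lemma FExt_sat S p q G (nu : nat -> V G) eta :
  foe_sat (FExt S p q) nu eta <-> is_ext S (proj1_sig (eta p)) (proj1_sig (eta q)).
Proof.
rewrite FLocal_sat; move: (proj1_sig (eta p)) (proj1_sig (eta q)) => r r'.
have okE j : letter_ok ext_guards (ext_labels S) (conv_dletter (pair_fun r r') j) <->
    posnode r j = posnode r' j \/ posnode r j = None.
  split.
    case=> g /= [<-|[<-|//]] /(_ _ (or_introl erefl)) /=; rewrite /pair_fun /=;
      case: (posnode r j) => [v|]; case: (posnode r' j) => [v'|] //=; try by [right | left].
    by case=> /gid_inj ->; left.
  case=> E.
    exists [:: AIdEq 0 (in0 0) (in1 0)]; first by left.
    by move=> a /= [<-|//] /=; rewrite /pair_fun /= E.
  exists [:: AIdEq 0 (in0 0) (IdSharp 2 0)]; first by right; left.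
  by move=> a /= [<-|//] /=; rewrite /pair_fun /= E.
have labE j : ext_labels S (conv_wletter (pair_fun r r') j) <->
    poslab r j = poslab r' j \/
    poslab r j = None /\ exists2 b, poslab r' j = Some b & S b.
  rewrite /ext_labels !ffunE /pair_fun /=; split.
    case/orP=> [/eqP->|/andP[/eqP->]]; first by left.
    by case: (poslab r' j) => // b Sb; right; split=> //; exists b.
  by case=> [->|[-> [b -> Sb]]]; rewrite ?eqxx //= Sb orbT.
case: r r' okE labE => [v s] [v' s'] okE labE; rewrite /is_ext /= onth_ext /plen /=.
have oN (o : option (Sigma * V G)) X (h : _ -> X) : omap h o = None <-> o = None by case: o.
split=> [[okd okw]|[Ev H]].
  split; first by have /okE[[]|] := okd 0 isT.
  by move=> j jlt; have /okE /= := okd j.+1 jlt; have /labE /= := okw j jlt; rewrite !oN.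
split=> [[|j] jlt|j jlt]; [apply/okE|apply/okE|apply/labE] => /=.
- by left; rewrite Ev.
- by rewrite oN; case: (H j jlt).
- by rewrite oN; case: (H j jlt).
Qed.

(** The convolution is as long as the longer path, so [q] is a longest one exactly when it is never
    padded. *)
Definition FLe p q := FLocal [:: [:: AIdNeq 0 (in1 0) (IdSharp 2 0)]] predT p q.

Lemma FLe_sat p q G (nu : nat -> V G) eta :
  foe_sat (FLe p q) nu eta <-> plen (proj1_sig (eta p)) <= plen (proj1_sig (eta q)).
Proof.
rewrite FLocal_sat; move: (proj1_sig (eta p)) (proj1_sig (eta q)) => r r'.
split=> [[okd _]|le]; last split=> // j jle.
  have [_ [<-|//] /(_ _ (or_introl erefl)) /=] := okd (plen r) (leq_maxl _ _).
  by rewrite /pair_fun /= posnode_isSome; case: (posnode r' _).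
exists [:: AIdNeq 0 (in1 0) (IdSharp 2 0)]; first by left.
move=> _ [<-|//] /=; rewrite /pair_fun /=.
have : j <= plen r' by lia.
by rewrite posnode_isSome; case: (posnode r' _).
Qed.

(** [pred0] rejects every word letter, which restricts the comparison to two one-node paths. *)
Definition FDataEq0 p q := FLocal [:: [:: ADEq 0 (DIn 0 ord0) (DIn 0 ord_max)]] pred0 p q.

Lemma FDataEq0_sat p q G (nu : nat -> V G) eta :
  foe_sat (FDataEq0 p q) nu eta <->
  [/\ plen (proj1_sig (eta p)) = 0, plen (proj1_sig (eta q)) = 0 &
      dataof (pfirst (proj1_sig (eta p))) = dataof (pfirst (proj1_sig (eta q)))].
Proof.
rewrite FLocal_sat; move: (proj1_sig (eta p)) (proj1_sig (eta q)) => r r'.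
split=> [[okd okw]|[-> -> Ed]]; last split=> // -[] // _.
  have {}okw : maxn (plen r) (plen r') = 0.
    by case E: (maxn _ _) okw => [|L] // /(_ 0 isT).
  have [_ [<-|//] /(_ _ (or_introl erefl)) /=] := okd 0 isT.
  by rewrite /pair_fun /= => -[->]; split=> //; lia.
exists [:: ADEq 0 (DIn 0 ord0) (DIn 0 ord_max)]; first by left.
by move=> _ [<-|//] /=; rewrite /pair_fun /= -/(pfirst r) Ed.
Qed.

Lemma valid_steps_cat G (v : V G) s t :
  valid_steps v (s ++ t) = valid_steps v s && valid_steps (last v (map snd s)) t.
Proof. by elim: s v => //= [[a w] s IH] v; rewrite IH andbA. Qed.

Lemma gpath_take G (r : gpath G) i : exists r' : gpath G,
  proj1_sig r' = ((proj1_sig r).1, take i (proj1_sig r).2).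
Proof.
case: r => [[v s] valid]; move: (valid); rewrite /is_path /= -{1}(cat_take_drop i s).
by rewrite valid_steps_cat => /andP[valid' _]; exists (exist _ (v, take i s) valid').
Qed.

(** Converts a position, given as the length of [c], into a prefix [w] of [p], whose last node is
    the node at that position. *)
Definition FAt p c w := FAnd (FExt predT w p) (FAnd (FLe w c) (FLe c w)).

Lemma FAt_sat p c w G (nu : nat -> V G) eta :
  let r := proj1_sig (eta p) in let i := plen (proj1_sig (eta c)) in
  foe_sat (FAt p c w) nu eta <-> i <= plen r /\ proj1_sig (eta w) = (r.1, take i r.2).
Proof.
move=> r i.
have -> : foe_sat (FAt p c w) nu eta <-> foe_sat (FExt predT w p) nu eta /\
   foe_sat (FLe w c) nu eta /\ foe_sat (FLe c w) nu eta by [].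
rewrite FExt_sat !FLe_sat -/r -/i; case: (proj1_sig (eta w)) => v s.
rewrite /is_ext /plen /=; split=> [[[-> [t -> _]] [le1 le2]]|[le [-> ->]]].
  rewrite size_cat take_cat; case: ltngtP le1 le2 => // -> _ _.
  by rewrite subnn take0 cats0; split=> //; lia.
rewrite size_takel //; split=> //; split=> //.
by exists (drop i r.2); rewrite ?cat_take_drop // all_predT.
Qed.

(** A one-state automaton cannot count, so adding exactly one step is expressed as a proper
    extension with no prefix strictly in between. *)
Definition FSucc a p q :=
  let z := (p + q).+1 in
  FAnd (FExt (pred1 a) p q) (FAnd (FNot (FLe q p))
    (FNot (FExP z (FAnd (FExt predT z q)
      (FAnd (FNot (FLe z p)) (FNot (FLe q z))))))).

Lemma FSucc_sat a p q G (nu : nat -> V G) eta :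
  let r := proj1_sig (eta p) in
  foe_sat (FSucc a p q) nu eta <->
  exists v, proj1_sig (eta q) = (r.1, rcons r.2 (a, v)).
Proof.
move=> r; set z := (p + q).+1.
have -> : foe_sat (FSucc a p q) nu eta <->
    foe_sat (FExt (pred1 a) p q) nu eta /\ ~ foe_sat (FLe q p) nu eta /\
    ~ exists s : gpath G, foe_sat (FExt predT z q) nu (upd eta z s) /\
       ~ foe_sat (FLe z p) nu (upd eta z s) /\ ~ foe_sat (FLe q z) nu (upd eta z s).
  by [].
rewrite FExt_sat FLe_sat -/r.
have E s : foe_sat (FExt predT z q) nu (upd eta z s) /\
     ~ foe_sat (FLe z p) nu (upd eta z s) /\ ~ foe_sat (FLe q z) nu (upd eta z s) <->
   is_ext predT (proj1_sig s) (proj1_sig (eta q)) /\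
     ~ plen (proj1_sig s) <= plen r /\ ~ plen (proj1_sig (eta q)) <= plen (proj1_sig s).
  by rewrite FExt_sat !FLe_sat /z; updE.
split=> [[[Er [t Et allt]] [nle nex]]|[v Eq]].
  case: t Et allt => [|[b v] [|[c w] t]] Et /= allt.
  - by case: nle; rewrite /plen Et cats0.
  - move: allt; rewrite andbT => /eqP Eb; exists v.
    by rewrite -cats1 -Eb Er -Et; case: (proj1_sig (eta q)).
  - case: nex; have [s Es] := gpath_take (eta q) (plen r).+1.
    exists s; apply/E; rewrite Es /plen /= Et size_takel size_cat /=; last by lia.
    split; last by split; lia.
    split=> //; exists (drop (size r.2).+1 (proj1_sig (eta q)).2).
      by rewrite -{1}Et cat_take_drop.
    exact: all_predT.
rewrite Eq /is_ext /plen /= size_rcons; split.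
  by split=> //; exists [:: (a, v)]; rewrite ?cats1 //= eqxx.
split; first by lia.
by case=> s /E; rewrite Eq /plen /= size_rcons; lia.
Qed.

End LocalAutomata.

(** * Walk logic *)

Section WalkLogic.
Variables (Sigma : finType) (Did Dprop : Type).
Implicit Type G : dgraph Sigma Did Dprop.

Fixpoint wl_bound (phi : wl Sigma) : nat :=
  match phi with
  | WE _ _ _ p | WLt _ _ p => p.+1
  | WId _ p _ q | WData _ p _ q => maxn p.+1 q.+1
  | WNot f => wl_bound f
  | WExPos _ p f | WExPath p f => maxn p.+1 (wl_bound f)
  | WOr f g => maxn (wl_bound f) (wl_bound g)
  end.

Lemma FAnd_sat (f g : foe Sigma) G (nu : nat -> V G) eta :
  foe_sat (FAnd f g) nu eta = (foe_sat f nu eta /\ foe_sat g nu eta).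
Proof. by []. Qed.

Lemma FNot_sat (f : foe Sigma) G (nu : nat -> V G) eta :
  foe_sat (FNot f) nu eta = ~ foe_sat f nu eta.
Proof. by []. Qed.

Lemma FExP2_sat p q (f : foe Sigma) G (nu : nat -> V G) eta :
  foe_sat (FExP p (FExP q f)) nu eta =
  exists r s, foe_sat f nu (upd (upd eta p r) q s).
Proof. by []. Qed.

Lemma gpath_nil G (v : V G) : exists r : gpath G, proj1_sig r = (v, [::]).
Proof. by exists (exist _ (v, [::]) isT). Qed.

Definition FAt2 (p c q d : nat) (body : nat -> nat -> foe Sigma) : foe Sigma :=
  let u := (p + c + q + d).+1 in
  FExP u (FExP u.+1 (FAnd (FAt Sigma p c u) (FAnd (FAt Sigma q d u.+1) (body u u.+1)))).

Lemma FAt2_sat p c q d body G (B : rawpath G -> rawpath G -> Prop)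
    (nu : nat -> V G) eta :
  (forall u w (eta' : nat -> gpath G), foe_sat (body u w) nu eta' <->
     B (proj1_sig (eta' u)) (proj1_sig (eta' w))) ->
  let r := proj1_sig (eta p) in let i := plen (proj1_sig (eta c)) in
  let s := proj1_sig (eta q) in let j := plen (proj1_sig (eta d)) in
  foe_sat (FAt2 p c q d body) nu eta <->
  i <= plen r /\ j <= plen s /\ B (r.1, take i r.2) (s.1, take j s.2).
Proof.
move=> bodyE r i s j; rewrite /FAt2; set u := (p + c + q + d).+1.
rewrite FExP2_sat.
have E ru rw : foe_sat (FAnd (FAt Sigma p c u) (FAnd (FAt Sigma q d u.+1) (body u u.+1)))
    nu (upd (upd eta u ru) u.+1 rw) <->
  (i <= plen r /\ proj1_sig ru = (r.1, take i r.2)) /\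
  (j <= plen s /\ proj1_sig rw = (s.1, take j s.2)) /\
  B (proj1_sig ru) (proj1_sig rw).
  by rewrite 2!FAnd_sat !FAt_sat bodyE /u; updE.
split=> [[ru [rw /E[[le ->] [[le' ->] Bu]]]] //|[le [le' Bu]]].
have [ru Eu] := gpath_take (eta p) i; have [rw Ew] := gpath_take (eta q) j.
by exists ru, rw; apply/E; rewrite Eu Ew.
Qed.

(** [FEnds] names both endpoints, so the starts are quantified away. Fixed node indices are
    harmless: only path variables matter to the formula. *)
Definition FSameEnd (u w : nat) : foe Sigma :=
  FExN 0 (FExN 1 (FExN 2 (FAnd (FEnds 0 u 2) (FEnds 1 w 2)))).

Lemma FSameEnd_sat u w G (nu : nat -> V G) eta :
  foe_sat (FSameEnd u w) nu eta <->
  plast (proj1_sig (eta u)) = plast (proj1_sig (eta w)).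
Proof.
split=> [[x [y [z /= [[_ ->] [_ ->]]]]] //|E].
exists (pfirst (proj1_sig (eta u))), (pfirst (proj1_sig (eta w))).
by exists (plast (proj1_sig (eta w))).
Qed.

(** The two ends generally sit at different positions, where no letter of the convolution shows
    both; one-node paths at these ends bring their data into a common letter. *)
Definition FDataEnd (u w : nat) : foe Sigma :=
  let a := (u + w).+1 in
  FExP a (FExP a.+1 (FAnd (FDataEq0 Sigma a a.+1)
    (FExN 0 (FExN 1 (FExN 2 (FExN 3 (FAnd (FAnd (FEnds 0 u 2) (FEnds 1 w 3))
      (FAnd (FEnds 2 a 2) (FEnds 3 a.+1 3))))))))).

Lemma FDataEnd_sat u w G (nu : nat -> V G) eta :
  foe_sat (FDataEnd u w) nu eta <->
  dataof (plast (proj1_sig (eta u))) = dataof (plast (proj1_sig (eta w))).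
Proof.
rewrite /FDataEnd; set a := (u + w).+1; rewrite FExP2_sat.
split=> [[ra [rb]]|E].
  rewrite FAnd_sat FDataEq0_sat => -[[_ _ Ed] [x [y [z [t]]]]] /=.
  move: Ed; rewrite /a; updE => Ed [[[_ Eu] [_ Ew]] [[Ea _] [Eb _]]].
  move: Eu Ew Ea Eb; rewrite /upd /= => -> -> <- <-; exact: Ed.
have [ra Ea] := gpath_nil (plast (proj1_sig (eta u))).
have [rb Eb] := gpath_nil (plast (proj1_sig (eta w))).
exists ra, rb; rewrite FAnd_sat FDataEq0_sat; split.
  by rewrite /a; updE; rewrite Ea Eb.
exists (pfirst (proj1_sig (eta u))), (pfirst (proj1_sig (eta w))).
exists (plast (proj1_sig (eta u))), (plast (proj1_sig (eta w))) => /=.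
by rewrite /a; updE; rewrite Ea Eb; updE.
Qed.

(* A position is represented by any path having that position as its length. *)
Definition pos_code (M : nat) (x : nat * nat) : nat := M + pickle x.

Fixpoint foe_of_wl (M : nat) (phi : wl Sigma) : foe Sigma :=
  let code l p := pos_code M (l, p) in
  match phi with
  | WE a l m p => FAt2 p (code l p) p (code m p) (FSucc a)
  | WLt l m p => FAnd (FLe Sigma (code l p) p)
      (FAnd (FLe Sigma (code m p) p) (FNot (FLe Sigma (code m p) (code l p))))
  | WId l p k q => FAt2 p (code l p) q (code k q) FSameEnd
  | WData l p k q => FAt2 p (code l p) q (code k q) FDataEnd
  | WNot f => FNot (foe_of_wl M f)
  | WOr f g => FNot (FAnd (FNot (foe_of_wl M f)) (FNot (foe_of_wl M g)))
  | WExPos l p f => FExP (code l p) (FAnd (FLe Sigma (code l p) p) (foe_of_wl M f))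
  | WExPath p f => FExP p (foe_of_wl M f)
  end.

Lemma posnode_take G (r : rawpath G) i v :
  posnode r i = Some v <-> i <= plen r /\ plast (r.1, take i r.2) = v.
Proof.
rewrite /plen /plast; case: r => w s /=.
elim: s w i => [|[a w'] s IH] w [|i] /=; rewrite ?take0 ?onth0n /=.
- by split=> [[->]|[_ ->]].
- by split=> [|[]].
- by split=> [[->]|[_ ->]].
- by rewrite ltnS -(IH w' i); case: i.
Qed.

Lemma WE_translation G (r : rawpath G) i j a :
  (i <= plen r /\ j <= plen r /\ j = i.+1 /\ poslab r j = Some a) <->
  (i <= plen r /\ j <= plen r /\ exists v, take j r.2 = rcons (take i r.2) (a, v)).
Proof.
case: r => w s; rewrite /plen /=; split=> [[le [le' [Ej lab]]]|[le [le' [v E]]]].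
  subst j; split=> //; split=> //; move: lab => /=; case E: (onth s i) => [[b v]|] //= [<-].
  exists v; rewrite (take_nth (b, v)); last by rewrite -onthTE E.
  by rewrite -odflt_onth E.
split=> //; split=> //.
have Ej : j = i.+1 by have /(congr1 size) := E; rewrite size_rcons !size_takel.
split=> //; subst j; rewrite /= onthE.
have -> : nth None (map Some s) i = onth (take i.+1 s) i.
  by rewrite onthE map_take nth_take.
by rewrite E -cats1 onth_cat size_takel // ltnn subnn.
Qed.

(** Codes are tied to [mu] by length alone, not as prefixes of the path concerned. The invariant
    therefore survives rebinding of that path variable, after which a position may exceed the new
    path; the atoms recheck this bound on both sides. *)
Lemma foe_of_wl_sat M phi G (nu : nat -> V G) eta mu eta' :
  wl_bound phi <= M -> (forall p, p < M -> eta' p = eta p) ->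
  (forall x, x \in wl_fpv phi -> plen (proj1_sig (eta' (pos_code M x))) = mu x) ->
  foe_sat (foe_of_wl M phi) nu eta' <-> wl_sat phi eta mu.
Proof.
elim: phi eta mu eta' => [a l m p|l m p|l p k q|l p k q|f IH|f IHf g IHg|l p f IH|p f IH]
  eta mu eta' bnd Eeta Emu.
- rewrite [foe_of_wl _ _]/= [wl_sat _ _ _]/=.
  rewrite (@FAt2_sat _ _ _ _ _ _ (fun r r' => exists v, r' = (r.1, rcons r.2 (a, v)))); last first.
    by move=> u w e; apply: FSucc_sat.
  rewrite !Emu ?inE ?eqxx ?orbT // Eeta // WE_translation /=.
  by split=> [[? [? [v [->]]]]|[? [? [v ->]]]]; split=> //; split=> //; exists v.
- rewrite [foe_of_wl _ _]/= 2!FAnd_sat FNot_sat !FLe_sat /=.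
  rewrite !Emu ?inE ?eqxx ?orbT // Eeta //.
  by split=> [[? [? /negP]]|[? [? ?]]]; split=> //; split=> //; lia.
- rewrite [foe_of_wl _ _]/= [wl_sat _ _ _]/=.
  rewrite (@FAt2_sat _ _ _ _ _ _ (fun r r' => plast r = plast r')); last first.
    by move=> u w e; apply: FSameEnd_sat.
  rewrite !Emu ?inE ?eqxx ?orbT // !Eeta; [|by move: bnd => /=; lia..].
  split=> [[le [le' E]]|[v [w [/posnode_take[le Ev] [/posnode_take[le' Ew] E]]]]].
    do 2!eexists; split; first by apply/posnode_take; split.
    by split; first by apply/posnode_take; split.
  by rewrite Ev Ew.
- rewrite [foe_of_wl _ _]/= [wl_sat _ _ _]/=.
  rewrite (@FAt2_sat _ _ _ _ _ _ (fun r r' => dataof (plast r) = dataof (plast r'))); last first.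
    by move=> u w e; apply: FDataEnd_sat.
  rewrite !Emu ?inE ?eqxx ?orbT // !Eeta; [|by move: bnd => /=; lia..].
  split=> [[le [le' E]]|[v [w [/posnode_take[le Ev] [/posnode_take[le' Ew] E]]]]].
    do 2!eexists; split; first by apply/posnode_take; split.
    by split; first by apply/posnode_take; split.
  by rewrite Ev Ew.
- by rewrite /= (IH eta mu).
- move: bnd; rewrite /= geq_max => /andP[bf bg].
  rewrite (IHf eta mu) ?(IHg eta mu) //; first by tauto.
    by move=> x xg; apply: Emu; rewrite mem_cat xg orbT.
  by move=> x xf; apply: Emu; rewrite mem_cat xf.
- move: bnd; rewrite /= geq_max => /andP[ltp bf].
  have E r i : plen (proj1_sig r) = i ->
      foe_sat (foe_of_wl M f) nu (upd eta' (pos_code M (l, p)) r) <->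
      wl_sat f eta (upd2 mu (l, p) i).
    move=> Er; apply: IH => // [q ltq|x xf].
      by rewrite upd_other ?Eeta // /pos_code; lia.
    rewrite /upd /upd2 eqn_add2l (inj_eq (pcan_inj pickleK)).
    by case: eqP => // /eqP nx; apply: Emu; rewrite /= mem_filter /= nx.
  have Ele r : foe_sat (FLe Sigma (pos_code M (l, p)) p) nu (upd eta' (pos_code M (l, p)) r) <->
      plen (proj1_sig r) <= plen (proj1_sig (eta p)).
    by rewrite FLe_sat upd_same upd_other ?Eeta // /pos_code; lia.
  split=> [[r [/Ele le /(E r _ erefl) H]]|[i [le H]]].
    by exists (plen (proj1_sig r)).
  have [r Er] := gpath_take (eta p) i; exists r.
  have szr : plen (proj1_sig r) = i by rewrite Er /plen /= size_takel.
  by split; [apply/Ele; rewrite szr | apply/(E r i szr)].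
- move: bnd; rewrite /= geq_max => /andP[ltp bf].
  have E r : foe_sat (foe_of_wl M f) nu (upd eta' p r) <-> wl_sat f (upd eta p r) mu.
    apply: IH => // [q ltq|x xf]; first by rewrite /upd; case: eqP => // _; apply: Eeta.
    by rewrite upd_other ?Emu // /pos_code; lia.
  by split=> -[r /E H]; exists r.
Qed.

Lemma WL_FOERDPQ : subsumed (WL Sigma Did Dprop) (FOERDPQ Sigma Did Dprop).
Proof.
case=> phi fpv; exists (foe_of_wl (wl_bound phi) phi) => G nu eta /=.
by apply: iff_sym; apply: foe_of_wl_sat => // x; rewrite (eqP fpv).
Qed.

End WalkLogic.

(** * Regular expressions and partial derivatives *)

Inductive re (T : Type) :=
| RVoid
| REps
| RAct of T
| RAlt of re T & re T
| RConc of re T & re T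
| RStar of re T.
Arguments RVoid {T}.
Arguments REps {T}.

Section RegexpCountable.
Variable T : countType.

(** Countability supplies the decidable equality and choice with which [seq_sub] turns a list of
    expressions into a finite type of states. *)
Fixpoint re_encode (e : re T) : GenTree.tree T :=
  match e with
  | RVoid => GenTree.Node 0 [::]
  | REps => GenTree.Node 1 [::]
  | RAct a => GenTree.Leaf a
  | RAlt e f => GenTree.Node 2 [:: re_encode e; re_encode f]
  | RConc e f => GenTree.Node 3 [:: re_encode e; re_encode f]
  | RStar e => GenTree.Node 4 [:: re_encode e]
  end.

Fixpoint re_decode (t : GenTree.tree T) : re T :=
  match t with
  | GenTree.Node 1 [::] => REps
  | GenTree.Leaf a => RAct a
  | GenTree.Node 2 [:: e; f] => RAlt (re_decode e) (re_decode f)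
  | GenTree.Node 3 [:: e; f] => RConc (re_decode e) (re_decode f)
  | GenTree.Node 4 [:: e] => RStar (re_decode e)
  | _ => RVoid
  end.

Lemma re_encodeK : cancel re_encode re_decode.
Proof. by elim=> //= [e -> f ->|e -> f ->|e ->]. Qed.

HB.instance Definition _ := Countable.copy (re T) (can_type re_encodeK).

End RegexpCountable.

Section Languages.
Variable T : countType.
Implicit Types (a : T) (w : seq T) (e f : re T).

Fixpoint lang e w : Prop :=
  match e with
  | RVoid => False
  | REps => w = [::]
  | RAct a => w = [:: a]
  | RAlt e f => lang e w \/ lang f w
  | RConc e f => exists w1 w2, [/\ w = w1 ++ w2, lang e w1 & lang f w2]
  | RStar e => exists2 ws, w = flatten ws & forall w', w' \in ws -> lang e w'
  end.

Fixpoint nullable e : bool :=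
  match e with
  | RVoid | RAct _ => false
  | REps | RStar _ => true
  | RAlt e f => nullable e || nullable f
  | RConc e f => nullable e && nullable f
  end.

Lemma nullableP e : lang e [::] <-> nullable e.
Proof.
elim: e => //= [e IHe f IHf|e IHe f IHf|e _].
- by rewrite IHe IHf; split=> /orP.
- split=> [[[|? ?] [w2 [//= <- /IHe-> /IHf->]]]|/andP[/IHe le /IHf lf]] //.
  by exists [::], [::].
- by split=> // _; exists [::].
Qed.

(* Antimirov's partial derivatives: [(a, f)] is a linear factor of [e] when [a]
   followed by a word of [f] is a word of [e]. *)
Fixpoint factors e : seq (T * re T) :=
  match e with
  | RVoid | REps => [::]
  | RAct a => [:: (a, REps)]
  | RAlt e f => factors e ++ factors f
  | RConc e f => [seq (x.1, RConc x.2 f) | x <- factors e] ++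
                 (if nullable e then factors f else [::])
  | RStar e => [seq (x.1, RConc x.2 (RStar e)) | x <- factors e]
  end.

Lemma lang_cons e a w :
  lang e (a :: w) <-> exists2 f, (a, f) \in factors e & lang f w.
Proof.
elim: e a w => [||b|e IHe f IHf|e IHe f IHf|e IHe] a w /=.
- by split=> [//|[]].
- by split=> [//|[]].
- split=> [[-> ->]|[f]]; first by exists REps; rewrite ?mem_head.
  by rewrite inE => /eqP[-> ->] /= ->.
- rewrite IHe IHf; split=> [[[g ag gw]|[g ag gw]]|[g]].
  + by exists g; rewrite // mem_cat ag.
  + by exists g; rewrite // mem_cat ag orbT.
  + by rewrite mem_cat => /orP[ag|ag] gw; [left|right]; exists g.
- split=> [[[|b w1] [w2 [E e1 f2]]]|[g]].
  + move: E f2 => /= <- /IHf[g ag gw]; exists g => //.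
    by rewrite mem_cat (introT idP (iffLR (nullableP e) e1)) ag orbT.
  + case: E e1 => <- -> /IHe[g ag gw]; exists (RConc g f); last by exists w1, w2.
    by rewrite mem_cat; apply/orP; left; apply/mapP; exists (a, g).
  + rewrite mem_cat => /orP[/mapP[[b g'] bg' [-> ->]]|].
      case=> w1 [w2 [-> g1 f2]]; exists (b :: w1), w2; split=> //.
      by apply/IHe; exists g'.
    case: ifP => // /nullableP ne ag gw; exists [::], (a :: w); split=> //.
    by apply/IHf; exists g.
- split=> [[ws]|[g /mapP[[b g'] bg' [-> ->]] [w1 [w2 [-> g1 [ws -> allws]]]]]].
    (* Empty blocks are skipped until the first block that supplies the letter [a]. *)
    elim: ws => // -[|b w1] ws IH E allws.
      by apply: IH => // w' inw'; apply: allws; rewrite inE inw' orbT.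
    case: E => -> ->; have /IHe[g bg gw] := allws _ (mem_head _ _).
    exists (RConc g (RStar e)); first by apply/mapP; exists (b, g).
    exists w1, (flatten ws); split=> //; exists ws => // w' inw'.
    by apply: allws; rewrite inE inw' orbT.
  exists ((b :: w1) :: ws) => // w'; rewrite inE => /orP[/eqP->|/allws //].
  by apply/IHe; exists g'.
Qed.

(** Only two properties matter: the list contains [e] and is closed under [factors]. It may include
    expressions that are never reached. *)
Fixpoint re_states e : seq (re T) :=
  match e with
  | RVoid => [:: RVoid]
  | REps => [:: REps]
  | RAct a => [:: RAct a; REps]
  | RAlt f g => e :: re_states f ++ re_states g
  | RConc f g => e :: [seq RConc h g | h <- re_states f] ++ re_states g
  | RStar f => e :: [seq RConc h (RStar f) | h <- re_states f]
  end.

Lemma mem_re_states e : e \in re_states e.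
Proof. by case: e => *; rewrite /= mem_head. Qed.

Lemma re_states_factors e f a g :
  f \in re_states e -> (a, g) \in factors f -> g \in re_states e.
Proof.
elim: e f a g => [||b|e1 IH1 e2 IH2|e1 IH1 e2 IH2|e1 IH1] f a g.
- by rewrite inE => /eqP->.
- by rewrite inE => /eqP->.
- by rewrite !inE => /orP[]/eqP-> //=; rewrite inE => /eqP[_ ->]; rewrite eqxx orbT.
- rewrite /= !inE mem_cat => /orP[/eqP->|/orP[f1|f2]].
  + rewrite /= mem_cat => /orP[] ag; rewrite mem_cat.
      by rewrite (IH1 _ _ _ (mem_re_states e1) ag) orbT.
    by rewrite (IH2 _ _ _ (mem_re_states e2) ag) !orbT.
  + by move=> ag; rewrite mem_cat (IH1 _ _ _ f1 ag) orbT.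
  + by move=> ag; rewrite mem_cat (IH2 _ _ _ f2 ag) !orbT.
- have conc h : h \in re_states e1 -> (a, g) \in factors (RConc h e2) ->
      g \in re_states (RConc e1 e2).
    move=> h1; rewrite /= !inE !mem_cat => /orP[/mapP[[b h'] bh' [_ ->]]|].
      apply/orP; right; apply/orP; left; apply/mapP; exists h' => //.
      exact: IH1 bh'.
    case: ifP => // _ ag; rewrite (IH2 _ _ _ (mem_re_states e2) ag) !orbT //.
  rewrite {1}/re_states -/re_states inE mem_cat => /orP[/eqP->|/orP[/mapP[h h1 ->]|f2]].
  + exact: conc (mem_re_states e1).
  + exact: conc.
  + by move=> ag; rewrite /= inE mem_cat (IH2 _ _ _ f2 ag) !orbT.
- have conc h : h \in re_states e1 -> (a, g) \in factors (RConc h (RStar e1)) ->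
      g \in re_states (RStar e1).
    have star h' : h' \in re_states e1 -> RConc h' (RStar e1) \in re_states (RStar e1).
      by move=> h'1; rewrite /= inE; apply/orP; right; apply/mapP; exists h'.
    move=> h1; rewrite [factors _]/= mem_cat => /orP[/mapP[[b h'] bh' [_ ->]]|].
      by apply: star; apply: IH1 bh'.
    case: ifP => // _ /mapP[[b h'] bh' [_ ->]].
    by apply: star; apply: IH1 (mem_re_states e1) bh'.
  rewrite {1}/re_states -/re_states inE => /orP[/eqP->|/mapP[h h1 ->]]; last exact: conc.
  move=> /mapP[[b h'] bh' [_ ->]]; rewrite /= inE; apply/orP; right.
  by apply/mapP; exists h' => //; apply: IH1 (mem_re_states e1) bh'.
Qed.

End Languages.

(** * Register programs as unary RDPAs *)

Section RegisterProgram.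
Variables (Sigma : finType) (Did Dprop : Type) (K : nat).
Implicit Type G : dgraph Sigma Did Dprop.

Definition test : finType := ('I_K + 'I_K + (bool * 'I_K * 'I_K))%type.
Definition action : finType := (test + option Sigma)%type.

Definition TBind (r : 'I_K) : action := inl (inl (inl r)).
Definition TCheck (r : 'I_K) : action := inl (inl (inr r)).
Definition TComp (b : bool) (r r' : 'I_K) : action := inl (inr (b, r, r')).
Definition TEdge (o : option Sigma) : action := inr o.

Definition store G := {ffun 'I_K -> option (V G)}.

Definition eq_iff (b : bool) (P : Prop) : Prop := if b then P else ~ P.

Definition test_ok G (s : store G) (v : V G) (t : test) : Prop :=
  match t with
  | inl (inl _) => True
  | inl (inr r) => s r = Some v
  | inr (b, r, r') =>
      eq_iff b (omap (@dataof _ _ _ G) (s r) = omap (@dataof _ _ _ G) (s r'))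
  end.

Definition test_do G (s : store G) (v : V G) (t : test) : store G :=
  if t is inl (inl r) then [ffun z => if z == r then Some v else s z] else s.

Fixpoint exec G (w : seq action) (s : store G) (v : V G) (p : seq (Sigma * V G))
    (s' : store G) : Prop :=
  match w with
  | [::] => p = [::] /\ s' = s
  | inl t :: w' => test_ok s v t /\ exec w' (test_do s v t) v p s'
  | inr o :: w' =>
      if p is (a, v') :: p' then
        [/\ (o == None) || (o == Some a), E v a v' & exec w' s v' p' s']
      else False
  end.

(* Summary of a sequence of tests performed at one node: the atoms required of the
   initial registers, where [None] stands for the current node, and the set of
   registers overwritten by the current node. *)
Definition sym_atom : finType := ('I_K + (bool * option 'I_K * option 'I_K))%type.
Definition symbolic : finType := ({set sym_atom} * {ffun 'I_K -> bool})%type.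

Definition sym_reg (c : {ffun 'I_K -> bool}) (r : 'I_K) : option 'I_K :=
  if c r then None else Some r.

(** Checking a register already bound at this node compares the node with itself, so no atom is
    added. *)
Definition sym_step (x : symbolic) (t : test) : symbolic :=
  match t with
  | inl (inl r) => (x.1, [ffun z => (z == r) || x.2 z])
  | inl (inr r) => (if x.2 r then x.1 else inl r |: x.1, x.2)
  | inr (b, r, r') => (inr (b, sym_reg x.2 r, sym_reg x.2 r') |: x.1, x.2)
  end.

Definition sym_init : symbolic := (set0, [ffun=> false]).

Definition sym_val G (s : store G) (v : V G) (o : option 'I_K) : option (V G) :=
  if o is Some r then s r else Some v.

Definition sym_atom_holds G (s : store G) (v : V G) (a : sym_atom) : Prop :=
  match a with
  | inl r => s r = Some v
  | inr (b, o, o') => eq_iff b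
      (omap (@dataof _ _ _ G) (sym_val s v o) = omap (@dataof _ _ _ G) (sym_val s v o'))
  end.

Definition sym_holds G (s : store G) v (x : symbolic) :=
  forall a, a \in x.1 -> sym_atom_holds s v a.

Definition sym_store G (s : store G) (v : V G) (x : symbolic) : store G :=
  [ffun r => if x.2 r then Some v else s r].

Lemma sym_regE G (s : store G) v x r : sym_val s v (sym_reg x.2 r) = sym_store s v x r.
Proof. by rewrite /sym_reg ffunE; case: ifP. Qed.

Lemma sym_step_holds G (s : store G) v x t :
  sym_holds s v (sym_step x t) <-> sym_holds s v x /\ test_ok (sym_store s v x) v t.
Proof.
have add a : (forall b, b \in a |: x.1 -> sym_atom_holds s v b) <->
    sym_holds s v x /\ sym_atom_holds s v a.
  split=> [H|[H Ha] b]; last by rewrite !inE => /orP[/eqP->|/H].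
  by split=> [b bx|]; apply: H; rewrite !inE ?bx ?eqxx ?orbT.
case: t => [[r|r]|[[b r] r']] /=.
- by split=> [|[]].
- rewrite ffunE /sym_holds /=; case: ifP => _; last by rewrite add.
  by split=> [|[]].
- by rewrite /sym_holds /= add /= !sym_regE.
Qed.

Lemma sym_step_store G (s : store G) v x t :
  sym_store s v (sym_step x t) = test_do (sym_store s v x) v t.
Proof.
case: t => [[r|r]|[[b r] r']] //=; apply/ffunP => z; rewrite !ffunE //=.
by case: (z == r).
Qed.

(** The induction needs an arbitrary accumulated summary [x]; all requirements refer to the store
    [s] from before the first test. *)
Lemma exec_tests G ts w (s : store G) v p s' x :
  sym_holds s v x /\ exec (map inl ts ++ w) (sym_store s v x) v p s' <->
  sym_holds s v (foldl sym_step x ts) /\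
    exec w (sym_store s v (foldl sym_step x ts)) v p s'.
Proof.
elim: ts x => //= t ts IH x.
by rewrite -IH sym_step_holds sym_step_store; tauto.
Qed.

Lemma exec_tests_init G ts w (s : store G) v p s' :
  exec (map inl ts ++ w) s v p s' <->
  sym_holds s v (foldl sym_step sym_init ts) /\
    exec w (sym_store s v (foldl sym_step sym_init ts)) v p s'.
Proof.
rewrite -exec_tests.
have -> : sym_store s v sym_init = s by apply/ffunP => r; rewrite !ffunE.
by split=> [|[]] //; split=> // a; rewrite inE.
Qed.

Lemma action_word_split (w : seq action) :
  (exists ts, w = map inl ts) \/
  (exists ts o w', w = map inl ts ++ inr o :: w').
Proof.
elim: w => [|[t|o] w IH]; first by left; exists [::].
  case: IH => [[ts ->]|[ts [o [w' ->]]]]; first by left; exists (t :: ts).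
  by right; exists (t :: ts), o, w'.
by right; exists [::], o, w.
Qed.

Variable e : re action.

Definition prog_state : finType := seq_sub (re_states e).

Lemma factor_state (q : prog_state) a f : (a, f) \in factors (val q) ->
  exists q' : prog_state, val q' = f.
Proof.
by move=> af; exists (SeqSub (re_states_factors (valP q) af)).
Qed.

(** Sequences of tests at one node can be arbitrarily long, but expressions paired with summaries
    form a finite type, so reachability by [connect] yields finitely many data transitions. *)
Definition eps : rel (prog_state * symbolic) := fun c c' =>
  [exists t : test, ((inl t, val c'.1) \in factors (val c.1)) && (c'.2 == sym_step c.2 t)].

Lemma eps_sound c c' : connect eps c c' ->
  exists2 ts, c'.2 = foldl sym_step c.2 ts &
    forall w, lang (val c'.1) w -> lang (val c.1) (map inl ts ++ w).
Proof.
case/connectP => cs; elim: cs c => [|d cs IH] c /=; first by move=> _ ->; exists [::].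
case/andP => /existsP[t /andP[td /eqP Ed]] /IH{}IH /IH[ts -> H].
exists (t :: ts); first by rewrite /= Ed.
by move=> w /H cw; apply/lang_cons; exists (val d.1).
Qed.

Lemma eps_complete (q : prog_state) x ts w : lang (val q) (map inl ts ++ w) ->
  exists2 q' : prog_state, connect eps (q, x) (q', foldl sym_step x ts) &
    lang (val q') w.
Proof.
elim: ts q x => [|t ts IH] q x /=; first by exists q.
case/lang_cons => f tf; have [q' Eq'] := factor_state tf.
rewrite -Eq' => /(IH _ (sym_step x t))[q'' con H]; exists q'' => //.
apply: connect_trans con; apply: connect1; apply/existsP; exists t.
by rewrite /= Eq' tf eqxx.
Qed.

Definition guard_reg (o : option 'I_K) : dterm 1 K :=
  if o is Some r then DReg 1 r else DIn K ord0.

Definition guard_of (a : sym_atom) : gatom 1 K K :=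
  match a with
  | inl r => AIdEq K (IdReg 1 r) (IdIn K ord0)
  | inr (b, o, o') =>
      if b then ADEq K (guard_reg o) (guard_reg o') else ADNeq K (guard_reg o) (guard_reg o')
  end.

Definition update_of (c : {ffun 'I_K -> bool}) : update 1 K K :=
  Update (fun r => if c r then Some (IdIn K ord0) else None)
         (fun r => if c r then Some (DIn K ord0) else None).

(** A data transition bundles all tests at a node and a word transition performs one edge action.
    Each program register becomes an id-register, used by checks, and a data-register, used by
    conditions. *)
Definition prog_rdpa : rdpa Sigma 1 :=
  @RDPA Sigma 1 prog_state prog_state (SeqSub (mem_re_states e))
    (fun q => nullable (val q)) K K
    (fun q w q' => [exists o : option Sigma,
       ((inr o, val q') \in factors (val q)) && ((o == None) || (o == w ord0))])
    (map (fun z : prog_state * prog_state * symbolic =>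
            (z.1.1, map guard_of (enum z.2.1), update_of z.2.2, z.1.2))
       (enum [pred z : prog_state * prog_state * symbolic |
          connect eps (z.1.1, sym_init) (z.1.2, z.2)])).

Definition store_regs G (s : store G) : regs Did Dprop prog_rdpa :=
  (fun r => omap (@gid _ _ _ G) (s r), fun r => omap (@dataof _ _ _ G) (s r)).

Lemma guard_ofE G (s : store G) v a :
  atom_holds (store_regs s) (node_letter v) (guard_of a) <-> sym_atom_holds s v a.
Proof.
have reg o : eval_d (store_regs s) (node_letter v) (guard_reg o) =
    omap (@dataof _ _ _ G) (sym_val s v o) by case: o.
case: a => [r|[[[] o] o']] /=; rewrite -?reg //.
by case: (s r) => [u|]; split=> //= [[/gid_inj ->]|[->]].
Qed.

Lemma update_ofE G (s : store G) v (x : symbolic) :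
  do_update (store_regs s) (node_letter v) (update_of x.2) = store_regs (sym_store s v x).
Proof.
by congr (_, _); apply: functional_extensionality => r /=; rewrite ffunE; case: ifP.
Qed.

(** [P] abstracts what follows the data letter, so that the last letter and the inner letters are
    treated alike. *)
Lemma prog_step G (q : prog_state) (s : store G) v
    (P : prog_state -> regs Did Dprop prog_rdpa -> Prop) :
  (exists g u q', List.In (q, g, u, q') (dtrans prog_rdpa) /\
     (forall a, List.In a g -> atom_holds (store_regs s) (node_letter v) a) /\
     P q' (do_update (store_regs s) (node_letter v) u)) <->
  (exists q' x, [/\ connect eps (q, sym_init) (q', x), sym_holds s v x &
     P q' (store_regs (sym_store s v x))]).
Proof.
split=> [[g [u [q' [/In_map[[[q1 q1'] x] /InP inz [-> -> -> ->]] [H Pq]]]]]|[q' [x [con H Pq]]]].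
  exists q1', x; move: inz; rewrite mem_enum inE /= => con; split=> //; last by rewrite -update_ofE.
  move=> a ax; apply/guard_ofE; apply: H; apply/In_map; exists a => //.
  by apply/InP; rewrite mem_enum.
exists [seq guard_of a | a <- enum x.1], (update_of x.2), q'; split.
  apply/In_map; exists (q, q', x) => //; apply/InP.
  by rewrite mem_enum inE.
rewrite update_ofE; split=> // _ /In_map[a /InP ax ->]; apply/guard_ofE.
by apply: H; rewrite mem_enum in ax.
Qed.

Lemma prog_acc_from G p (q : prog_state) (s : store G) v : valid_steps v p ->
  acc_from (A := prog_rdpa) q (store_regs s) (node_letter v) (step_letters p) <->
  exists w s', lang (val q) w /\ exec w s v p s'.
Proof.
elim: p q s v => [|[a v'] p IH] q s v.
  move=> _; rewrite [acc_from _ _ _ _]/=.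
  rewrite (prog_step q s v (fun q' _ => nullable (val q'))); split.
    case=> q' [x [/eps_sound[ts /= -> H] hold /nullableP /H]]; rewrite cats0 => qts.
    exists (map inl ts); exists (sym_store s v (foldl sym_step sym_init ts)).
    by split=> //; rewrite -[map _ _]cats0; apply/exec_tests_init.
  case=> w [s' []]; case: (action_word_split w) => [[ts ->]|[ts [o [w' ->]]]].
    rewrite -[map _ _]cats0 => /eps_complete-/(_ sym_init)[q' con /nullableP nl].
    by case/exec_tests_init => hold _; exists q', (foldl sym_step sym_init ts).
  by move=> _ /exec_tests_init[_ []].
rewrite [valid_steps _ _]/= => /andP[Evv valid]; rewrite [acc_from _ _ _ _]/=.
rewrite (prog_step q s v (fun q' rho => exists q'', [exists o : option Sigma,
   ((inr o, val q'') \in factors (val q')) && ((o == None) || (o == [ffun=> Some a] ord0))]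
   /\ acc_from (A := prog_rdpa) q'' rho (node_letter v') (step_letters p))); split.
  case=> q' [x [/eps_sound[ts /= -> H] hold [q'' [/existsP[o /andP[oq'' oa]]]]]].
  move/IH=> /(_ valid)[w [s' [lw ew]]]; exists (map inl ts ++ inr o :: w), s'.
  split; first by apply: H; apply/lang_cons; exists (val q'').
  by apply/exec_tests_init; split=> //=; split=> //; rewrite ffunE in oa.
case=> w [s' []]; case: (action_word_split w) => [[ts ->]|[ts [o [w' ->]]]].
  by rewrite -[map _ _]cats0 => _ /exec_tests_init[_ []].
move=> /eps_complete-/(_ sym_init)[q' con /lang_cons[f of' lf]].
have [q'' Eq''] := factor_state of'; subst f.
case/exec_tests_init => hold [oa _ ew]; exists q', (foldl sym_step sym_init ts).
split=> //; exists q''; split; last by apply/IH => //; exists w', s'.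
by apply/existsP; exists o; rewrite of' ffunE.
Qed.

Definition store_init G : store G := [ffun=> None].

Lemma prog_rdpa_accepts G (r : rawpath G) : is_path r ->
  rdpa_accepts prog_rdpa (convolution (fun _ : 'I_1 => r)) <->
  exists w s', lang e w /\ exec w (store_init G) r.1 r.2 s'.
Proof.
move=> valid; rewrite convolution_unary /rdpa_accepts /=.
have -> : (fun _ => None, fun _ => None) = store_regs (store_init G).
  by congr (_, _); apply: functional_extensionality => i /=; rewrite ffunE.
exact: prog_acc_from.
Qed.

End RegisterProgram.

(** * Patterns as register programs *)

Section PatternPrograms.
Variables (Sigma : finType) (Did Dprop : Type) (K : nat).
Implicit Type G : dgraph Sigma Did Dprop.
Local Notation action := (action Sigma K).

Definition runs G (e : re action) (s : store K G) v p s' :=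
  exists2 w, lang e w & exec w s v p s'.

Lemma exec_cat G (w1 w2 : seq action) (s : store K G) v p s' :
  exec (w1 ++ w2) s v p s' <->
  exists p1 p2 s1, [/\ p = p1 ++ p2, exec w1 s v p1 s1 &
    exec w2 s1 (last v (map snd p1)) p2 s'].
Proof.
elim: w1 s v p => [|[t|o] w1 IH] s v p /=.
- split=> [H|[p1 [p2 [s1 [-> [-> ->]]]]] //].
  by exists [::], p, s.
- rewrite IH; split=> [[ok [p1 [p2 [s1 [-> H1 H2]]]]]|[p1 [p2 [s1 [-> [ok H1] H2]]]]].
    by exists p1, p2, s1.
  by split=> //; exists p1, p2, s1.
- split.
    case: p => // -[a v'] p [oa Ev /IH[p1 [p2 [s1 [-> H1 H2]]]]].
    by exists ((a, v') :: p1), p2, s1.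
  case=> -[|[a v'] p1] [p2 [s1 [-> //= [oa Ev H1] H2]]].
  by split=> //; apply/IH; exists p1, p2, s1.
Qed.

Lemma exec_valid G (w : seq action) (s : store K G) v p s' :
  exec w s v p s' -> valid_steps v p.
Proof.
elim: w s v p => [|[t|o] w IH] s v p /=; first by case=> ->.
  by case=> _ /IH.
by case: p => //= -[a v'] p [_ -> /IH].
Qed.

Lemma runs_eps G (s : store K G) v p s' : runs REps s v p s' <-> p = [::] /\ s' = s.
Proof. by split=> [[_ ->]|] //; exists [::]. Qed.

Lemma runs_void G (s : store K G) v p s' : runs RVoid s v p s' <-> False.
Proof. by split=> // -[]. Qed.

Lemma runs_test G (t : test K) (s : store K G) v p s' :
  runs (RAct (inl t)) s v p s' <-> [/\ test_ok s v t, p = [::] & s' = test_do s v t].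
Proof. by split=> [[_ -> [ok [-> ->]]]|[ok -> ->]] //; exists [:: inl t]. Qed.

Lemma runs_edge G o (s : store K G) v p s' :
  runs (RAct (TEdge K o)) s v p s' <->
  s' = s /\ exists a v', [/\ p = [:: (a, v')], (o == None) || (o == Some a) & E v a v'].
Proof.
split=> [[_ ->] /=|[-> [a [v' [-> oa Ev]]]]]; last by exists [:: TEdge K o].
by case: p => // -[a v'] p [oa Ev [-> ->]]; split=> //; exists a, v'.
Qed.

Lemma runs_alt G e f (s : store K G) v p s' :
  runs (RAlt e f) s v p s' <-> runs e s v p s' \/ runs f s v p s'.
Proof.
split=> [[w [ew|fw] H]|[[w ew H]|[w fw H]]].
- by left; exists w.
- by right; exists w.
- by exists w => //; left.
- by exists w => //; right.
Qed.

Lemma runs_conc G e f (s : store K G) v p s' :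
  runs (RConc e f) s v p s' <->
  exists p1 p2 s1, [/\ p = p1 ++ p2, runs e s v p1 s1 &
    runs f s1 (last v (map snd p1)) p2 s'].
Proof.
split.
  case=> _ [w1 [w2 [-> ew fw]]] /exec_cat[p1 [p2 [s1 [-> H1 H2]]]].
  by exists p1, p2, s1; split=> //; [exists w1 | exists w2].
case=> p1 [p2 [s1 [-> [w1 e1 H1] [w2 f2 H2]]]].
exists (w1 ++ w2); first by exists w1, w2.
by apply/exec_cat; exists p1, p2, s1.
Qed.

Definition ralt (es : seq (re action)) : re action := foldr (@RAlt _) RVoid es.

Lemma runs_ralt G es (s : store K G) v p s' :
  runs (ralt es) s v p s' <-> exists2 e, e \in es & runs e s v p s'.
Proof.
elim: es => [|e es IH]; first by rewrite runs_void; split=> // -[].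
rewrite /= runs_alt IH; split=> [[H|[f fes H]]|[f]].
- by exists e; rewrite ?mem_head.
- by exists f; rewrite // inE fes orbT.
- by rewrite inE => /orP[/eqP->|fes] H; [left | right; exists f].
Qed.

Fixpoint rpow (e : re action) (n : nat) : re action :=
  if n is n'.+1 then RConc e (rpow e n') else REps.

Lemma lang_rpow (e : re action) n w :
  lang (rpow e n) w <->
  exists2 ws, w = flatten ws & size ws = n /\ forall w', w' \in ws -> lang e w'.
Proof.
elim: n w => [|n IH] w /=.
  split=> [->|[[|? ?] -> []] //]; by exists [::].
split=> [[w1 [w2 [-> e1 /IH[ws -> [<- allws]]]]]|[[|w1 ws] -> [] //= [sz] allws]].
  by exists (w1 :: ws) => //; split=> // w'; rewrite inE => /orP[/eqP->|/allws].
exists w1, (flatten ws); split=> //; first by apply: allws; rewrite mem_head.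
by apply/IH; exists ws => //; split=> // w' inw'; apply: allws; rewrite inE inw' orbT.
Qed.

Definition rrep (e : re action) (lo : nat) (hi : option nat) : re action :=
  if hi is Some h then ralt [seq rpow e n | n <- iota lo (h.+1 - lo)]
  else RConc (rpow e lo) (RStar e).

Lemma runs_rrep G e lo hi (s : store K G) v p s' :
  runs (rrep e lo hi) s v p s' <->
  exists n, [/\ lo <= n, if hi is Some h then n <= h else True &
    runs (rpow e n) s v p s'].
Proof.
case: hi => [h|] /=.
  rewrite runs_ralt; split=> [[f /mapP[n +] Ef H]|[n [le le' H]]].
    by subst f; rewrite mem_iota => le; exists n; split=> //; lia.
  by exists (rpow e n) => //; apply/mapP; exists n; rewrite // mem_iota; lia.
split=> [[_ [w1 [w2 [-> /lang_rpow[ws1 -> [sz1 all1]] [ws2 -> all2]]]] H]|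
         [n [le _ [_ /lang_rpow[ws -> [szw allws]] H]]]].
  exists (size (ws1 ++ ws2)); rewrite size_cat sz1 leq_addr; split=> //.
  exists (flatten ws1 ++ flatten ws2) => //; apply/lang_rpow.
  exists (ws1 ++ ws2); rewrite ?flatten_cat // size_cat sz1; split=> // w'.
  by rewrite mem_cat => /orP[/all1|/all2].
exists (flatten ws) => //; exists (flatten (take lo ws)), (flatten (drop lo ws)).
rewrite -flatten_cat cat_take_drop; split=> //.
  apply/lang_rpow; exists (take lo ws) => //; split; first by rewrite size_takel ?szw.
  by move=> w' /mem_take; apply: allws.
by exists (drop lo ws) => // w' /mem_drop; apply: allws.
Qed.

(** The store invariant [F] will record that registers of the enclosing depths keep their values. *)
Lemma runs_rpow_chain G e n (P : rawpath G -> Prop) (F : store K G -> Prop) s v p s' :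
  (forall s v p s', F s -> runs e s v p s' -> P (v, p) /\ F s') -> F s ->
  runs (rpow e n) s v p s' ->
  F s' /\ exists rs, [/\ size rs = n, forall r, List.In r rs -> P r & chain rs (v, p)].
Proof.
move=> eP; elim: n s v p => [|n IH] s v p Fs.
  by move=> /runs_eps[-> ->]; split=> //; exists [::].
case/runs_conc => p1 [p2 [s1 [-> /(eP _ _ _ _ Fs)[P1 Fs1] /(IH _ _ _ Fs1)[Fs' [rs [sz Prs ch]]]]]].
split=> //; exists ((v, p1) :: rs); rewrite /= sz; split=> // [r [<- //|/Prs //]|].
by exists (last v (map snd p1), p2).
Qed.

(** A run is demanded from every store, because later iterations start with whatever earlier ones
    left behind. *)
Lemma chain_runs_rpow G e (P : rawpath G -> Prop) s (rs : seq (rawpath G)) rho :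
  (forall s r, P r -> exists s', runs e s r.1 r.2 s') ->
  (forall r, List.In r rs -> P r) -> chain rs rho ->
  exists s', runs (rpow e (size rs)) s rho.1 rho.2 s'.
Proof.
move=> eP; elim: rs s rho => [|r rs IH] s rho Prs /=.
  by move=> ->; exists s; apply/runs_eps.
case=> rho' [ch [Ef ->]]; have [s1 H1] := eP s r (Prs _ (or_introl erefl)).
have [s' H2] := IH s1 rho' (fun r' inr' => Prs r' (or_intror inr')) ch.
exists s'; apply/runs_conc; exists r.2, rho'.2, s1; split=> //.
by move: H2; rewrite -/(pfirst rho') Ef.
Qed.

(* [reg d x] holds the value of variable [x] at repetition depth [d]. *)
Variable reg : nat -> nat -> 'I_K.

(** The polarity [b] pushes negations down to the atoms, as expressions have no complement. An atom
    with an undefined variable is false: [RVoid] when positive, [REps] when negated. *)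
Fixpoint cond_re (D : seq nat) (d : nat) (b : bool) (t : gcond) : re action :=
  match t with
  | CData x y =>
      if (x \in D) && (y \in D) then RAct (TComp Sigma b (reg d x) (reg d y))
      else if b then RVoid else REps
  | CNot t => cond_re D d (~~ b) t
  | CAnd t u =>
      if b then RConc (cond_re D d b t) (cond_re D d b u)
      else RAlt (cond_re D d b t) (cond_re D d b u)
  end.

Lemma runs_cond_re G D d b t mu (s : store K G) v p s' :
  (forall z, mu z = if z \in D then s (reg d z) else None) ->
  (forall z, z \in D -> s (reg d z)) ->
  runs (cond_re D d b t) s v p s' <-> [/\ p = [::], s' = s & eq_iff b (cond_sat mu t)].
Proof.
move=> Emu someD; elim: t b p s' => [x y|t IH|t IHt u IHu] b p s' /=.
- case: ifP => [/andP[xD yD]|ND].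
    rewrite runs_test /= !Emu xD yD.
    case: (s (reg d x)) (someD x xD) => // vx _; case: (s (reg d y)) (someD y yD) => // vy _.
    have E : (exists v0 w : V G, Some vx = Some v0 /\ Some vy = Some w /\
        dataof v0 = dataof w) <-> Some (dataof vx) = Some (dataof vy).
      by split=> [[? [? [[<-] [[<-] ->]]]] //|[Ed]]; exists vx, vy.
    by case: b => /=; split=> [[/E H -> ->]|[-> -> /E H]].
  have nex : ~ cond_sat mu (CData x y).
    by case=> v0 [w [+ [+ _]]]; rewrite !Emu; move: ND; case: ifP; case: ifP.
  case: b; [rewrite runs_void | rewrite runs_eps]; split=> //.
  - by case.
  - by case=> -> ->.
  - by case.
- rewrite IH; case: b => //=; split=> -[-> -> H]; split=> //; tauto.
- case: b.
    rewrite runs_conc; split.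
      by case=> p1 [p2 [s1 [-> /IHt[-> -> ct]]]] /= ; rewrite IHu => -[-> -> cu].
    case=> -> -> [ct cu]; exists [::], [::], s; split=> //; first exact/IHt.
    exact/IHu.
  rewrite runs_alt IHt IHu /=; split.
    by case=> -[-> -> nc]; split=> //; tauto.
  case=> -> -> nc; have [ct|nt] := classic (cond_sat mu t); [right|left]; split=> //.
  by move=> cu; apply: nc.
Qed.

(** [B] collects what is bound to the left, so the right factor of a concatenation is recompiled for
    each domain of the left one. A repetition body restarts with nothing bound, one depth further
    in, and exports no variable. *)
Fixpoint compile (d : nat) (B : seq nat) (p : pattern Sigma) : seq (seq nat * re action) :=
  match p with
  | PEmpty => [:: ([::], REps)]
  | PVar x =>
      [:: ([:: x], RAct (if x \in B then TCheck Sigma (reg d x) else TBind Sigma (reg d x)))]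
  | PEdge => [:: ([::], RAct (TEdge K None))]
  | PLab a => [:: ([::], RAct (TEdge K (Some a)))]
  | PUnion p1 p2 => compile d B p1 ++ compile d B p2
  | PConc p1 p2 =>
      [seq (c1.1 ++ c2.1, RConc c1.2 c2.2) |
         c1 <- compile d B p1, c2 <- compile d (c1.1 ++ B) p2]
  | PRep p lo hi => [:: ([::], rrep (ralt (map snd (compile d.+1 [::] p))) lo hi)]
  | PCond p t => [seq (c.1, RConc c.2 (cond_re c.1 d true t)) | c <- compile d B p]
  end.

Fixpoint rep_depth (p : pattern Sigma) : nat :=
  match p with
  | PUnion p1 p2 | PConc p1 p2 => maxn (rep_depth p1) (rep_depth p2)
  | PRep p _ _ => (rep_depth p).+1
  | PCond p _ => rep_depth p
  | _ => 0
  end.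

Variables (maxdepth maxvar : nat).
Hypothesis reg_inj : forall d x d' x', d <= maxdepth -> x <= maxvar ->
  d' <= maxdepth -> x' <= maxvar -> reg d x = reg d' x' -> d = d' /\ x = x'.

Definition bounded (s : seq nat) := forall x, x \in s -> x <= maxvar.

Lemma bounded_nil : bounded [::].
Proof. by []. Qed.

Definition reads_off G (mu : nat -> option (V G)) (D : seq nat) d (s : store K G) :=
  forall z, mu z = if z \in D then s (reg d z) else None.

(** The last three clauses are frame conditions: conditions test defined registers, bindings of a
    left factor survive the right one, and repetitions leave the enclosing depths intact. *)
Lemma compile_sound p d B c : d + rep_depth p <= maxdepth -> bounded (pvars p) -> bounded B ->
  c \in compile d B p -> bounded c.1 /\
  forall G (s : store K G) v r s', runs c.2 s v r s' ->
  exists mu, [/\ pat_sem p (v, r) mu, reads_off mu c.1 d s' &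
    [/\ forall z, z \in c.1 -> s' (reg d z), forall z, z \in B -> s' (reg d z) = s (reg d z) &
      forall d' x, d' < d -> x <= maxvar -> s' (reg d' x) = s (reg d' x)]].
Proof.
elim: p d B c => [|x||a|p1 IH1 p2 IH2|p1 IH1 p2 IH2|p IH lo hi|p IH t] d B c /=.
- move=> _ _ _; rewrite inE => /eqP-> /=; split=> // G s v r s' /runs_eps[-> ->].
  by exists (fun _ => None).
- rewrite addn0 => led bx bB; rewrite inE => /eqP-> /=; split=> // G s v r s' H.
  have [-> sx others] : [/\ r = [::], s' (reg d x) = Some v &
      forall k, k <> reg d x \/ x \in B -> s' k = s k].
    move: H; case: ifP => xB /runs_test /= [H -> ->]; split=> //; rewrite ?ffunE ?eqxx //.
    by move=> k [ne|//]; rewrite ffunE; case: eqP.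
  exists (fun z => if z == x then Some v else None); split=> //.
    by move=> z; rewrite inE; case: eqP => // ->.
  split=> [z|z zB|d' y ltd ley].
  + by rewrite inE => /eqP->; rewrite sx.
  + apply: others; have [<-|/eqP nzx] := eqVneq z x; [by right | left].
    by case/reg_inj => //; [exact: bB | apply: bx; rewrite inE].
  + apply: others; left; case/reg_inj => //; [by lia | by apply: bx; rewrite inE | ].
    by lia.
- move=> _ _ _; rewrite inE => /eqP-> /=; split=> // G s v r s'.
  case/runs_edge => -> [a [v' [-> _ Ev]]]; exists (fun _ => None).
  by do 2!split=> //; exists a, v'.
- move=> _ _ _; rewrite inE => /eqP-> /=; split=> // G s v r s'.
  case/runs_edge => -> [b [v' [-> /= /eqP[<-] Ev]]]; exists (fun _ => None).
  by do 2!split=> //; exists v'.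
- move=> led bnd bB; rewrite mem_cat.
  have bnd1 : bounded (pvars p1) by move=> x x1; apply: bnd; rewrite mem_cat x1.
  have bnd2 : bounded (pvars p2) by move=> x x2; apply: bnd; rewrite mem_cat x2 orbT.
  case/orP => [/IH1|/IH2] []; rewrite // ?(leq_trans _ led) ?leq_add2l ?leq_maxl ?leq_maxr //;
    move=> bc H; split=> // G s v r s' /H[mu [sem ro fr]]; exists mu; split=> //.
  + by left.
  + by right.
- move=> led bnd bB.
  have bnd1 : bounded (pvars p1) by move=> x x1; apply: bnd; rewrite mem_cat x1.
  have bnd2 : bounded (pvars p2) by move=> x x2; apply: bnd; rewrite mem_cat x2 orbT.
  case/allpairsPdep => c1 [c2 [/IH1 [||//|bc1 H1]]] //.
    by apply: leq_trans led; rewrite leq_add2l leq_maxl.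
  have bB2 : bounded (c1.1 ++ B) by move=> x; rewrite mem_cat => /orP[/bc1|/bB].
  case/IH2 => // [|bc2 H2 ->]; first by apply: leq_trans led; rewrite leq_add2l leq_maxr.
  split=> [x|G s v r s'] /=; first by rewrite mem_cat => /orP[/bc1|/bc2].
  case/runs_conc => r1 [r2 [s1 [->]]].
  move=> /H1[m1 [sem1 ro1 [so1 fr1 lo1]]] /H2[m2 [sem2 ro2 [so2 fr2 lo2]]].
  have keep z : z \in c1.1 -> s' (reg d z) = s1 (reg d z).
    by move=> zc; apply: fr2; rewrite mem_cat zc.
  exists (fun z => if m1 z is Some v then Some v else m2 z); split.
  + exists (v, r1), m1, (last v (map snd r1), r2), m2; split=> //; split=> //.
    split=> //; split=> //; split=> // z w w'; rewrite ro1 ro2.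
    by case: ifP => // /keep<- ->; case: ifP => // _ [].
  + move=> z; rewrite ro1 mem_cat; case: ifP => zc1 /=; last by rewrite ro2.
    by rewrite keep //; case: (s1 _) (so1 z zc1).
  split=> [z|z zB|d' x ltd lex].
  + rewrite mem_cat => /orP[zc1|/so2 //]; rewrite keep //; exact: so1.
  + by rewrite fr2 ?fr1 // mem_cat zB orbT.
  + by rewrite lo2 ?lo1.
- move=> led bnd bB; rewrite inE => /eqP-> /=; split=> // G s v r s'.
  case/runs_rrep => n [le le' H].
  have led1 : d.+1 + rep_depth p <= maxdepth by rewrite addSnnS.
  (* Depth [d] itself is included, because the iterations run at depth [d.+1]; this yields the
     clause about [B]. *)
  pose F (s1 : store K G) := forall d' x, d' < d.+1 -> x <= maxvar ->
    s1 (reg d' x) = s (reg d' x).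
  have [|//|Fs' [rs [sz Prs ch]]] := runs_rpow_chain (P := fun r => exists m, pat_sem p r m)
    (F := F) _ _ H.
    move=> s1 w q s2 Fs1 /runs_ralt[_ /mapP[c' c'p ->]].
    have [_ H'] := IH _ _ _ led1 bnd bounded_nil c'p.
    case/H' => mu [sem _ [_ _ lo']]; split; first by exists mu.
    by move=> d' x ltd lex; rewrite lo' ?Fs1.
  exists (fun _ => None); split=> //.
    by split=> //; exists rs; rewrite sz.
  by split=> // [z zB|d' x ltd lex]; apply: Fs' => //; [exact: bB | lia].
- move=> led bnd bB /mapP[c' c'p ->] /=.
  have bnd1 : bounded (pvars p) by move=> x x1; apply: bnd; rewrite mem_cat x1.
  have [bc H] := IH _ _ _ led bnd1 bB c'p; split=> // G s v r s'.
  case/runs_conc => r1 [r2 [s1 [-> /H[mu [sem ro [so fr lo]]]]]].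
  rewrite (runs_cond_re _ _ _ _ _ ro so) => -[-> -> ct].
  by rewrite cats0; exists mu.
Qed.

(** The store has to agree with [mu] only on those variables of [B] that [mu] defines, since a
    branch need not mention all of [B]. *)
Lemma compile_complete p d B : d + rep_depth p <= maxdepth -> bounded (pvars p) -> bounded B ->
  forall G (s : store K G) r mu, pat_sem p r mu ->
  (forall z v, z \in B -> mu z = Some v -> s (reg d z) = Some v) ->
  exists2 c, c \in compile d B p &
    exists2 s', runs c.2 s r.1 r.2 s' & reads_off mu c.1 d s'.
Proof.
elim: p d B => [|x||a|p1 IH1 p2 IH2|p1 IH1 p2 IH2|p IH lo hi|p IH t] d B /=.
- move=> _ _ _ G s r mu [-> Emu] _; exists ([::], REps); rewrite ?mem_head //.
  by exists s => //; apply/runs_eps.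
- move=> _ _ _ G s r mu [-> Emu] sB; eexists; first exact: mem_head.
  case: ifP => xB /=.
    exists s; first by apply/runs_test; split=> //=; apply: sB; rewrite // Emu eqxx.
    by move=> z; rewrite inE Emu; case: eqP => // ->; rewrite (sB x r.1) ?Emu ?eqxx.
  exists (test_do s r.1 (inl (inl (reg d x)))); first exact/runs_test.
  by move=> z; rewrite inE Emu; case: eqP => // ->; rewrite ffunE eqxx.
- move=> _ _ _ G s r mu [[a [v' [-> Ev]]] Emu] _; eexists; first exact: mem_head.
  by exists s => //; apply/runs_edge; split=> //; exists a, v'.
- move=> _ _ _ G s r mu [[v' [-> Ev]] Emu] _; eexists; first exact: mem_head.
  by exists s => //; apply/runs_edge; split=> //; exists a, v'; rewrite eqxx.
- move=> led bnd bB G s r mu.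
  have bnd1 : bounded (pvars p1) by move=> x x1; apply: bnd; rewrite mem_cat x1.
  have bnd2 : bounded (pvars p2) by move=> x x2; apply: bnd; rewrite mem_cat x2 orbT.
  have [led1 led2] : d + rep_depth p1 <= maxdepth /\ d + rep_depth p2 <= maxdepth by lia.
  by case=> [/IH1|/IH2] H /H[] // c cp Hc; exists c; rewrite // mem_cat cp ?orbT.
- move=> led bnd bB G s r mu.
  have bnd1 : bounded (pvars p1) by move=> x x1; apply: bnd; rewrite mem_cat x1.
  have bnd2 : bounded (pvars p2) by move=> x x2; apply: bnd; rewrite mem_cat x2 orbT.
  have [led1 led2] : d + rep_depth p1 <= maxdepth /\ d + rep_depth p2 <= maxdepth by lia.
  case=> r1 [m1 [r2 [m2 [sem1 [sem2 [Er [-> [agr Emu]]]]]]]] sB.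
  have [|c1 c1p [s1 run1 ro1]] := IH1 d B led1 bnd1 bB G s r1 m1 sem1.
    by move=> z v zB Em; apply: sB => //; rewrite Emu Em.
  (* Soundness is applied to the run just found, for its frame conditions. *)
  have [bc1 /(_ _ _ _ _ _ run1)[m1' [_ ro1' [so1 fr1 _]]]] := compile_sound led1 bnd1 bB c1p.
  have bB2 : bounded (c1.1 ++ B) by move=> x; rewrite mem_cat => /orP[/bc1|/bB].
  have [|c2 c2p [s2 run2 ro2]] := IH2 d (c1.1 ++ B) led2 bnd2 bB2 G s1 r2 m2 sem2.
    move=> z w zB Em2; case zc: (z \in c1.1).
      have := ro1 z; rewrite zc; case E: (s1 (reg d z)) (so1 z zc) => [u|] // _ Em1.
      by rewrite (agr z u w).
    move: zB; rewrite mem_cat zc /= => zB; rewrite fr1 //; apply: sB => //.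
    by rewrite Emu ro1 zc.
  have [bc2 /(_ _ _ _ _ _ run2)[_ [_ _ [_ fr2 _]]]] := compile_sound led2 bnd2 bB2 c2p.
  exists (c1.1 ++ c2.1, RConc c1.2 c2.2).
    by apply/allpairsPdep; exists c1, c2.
  exists s2 => /=.
    by apply/runs_conc; exists r1.2, r2.2, s1; rewrite -/(plast r1) Er.
  move=> z; rewrite Emu ro1 mem_cat; case: ifP => zc1 /=; last exact: ro2.
  rewrite fr2; last by rewrite mem_cat zc1.
  by case: (s1 _) (so1 z zc1).
- move=> led bnd bB G s r mu [Emu [rs [le [le' [Prs ch]]]]] _.
  eexists; first exact: mem_head.
  have led1 : d.+1 + rep_depth p <= maxdepth by rewrite addSnnS.
  have [|s' H] := chain_runs_rpow (e := ralt (map snd (compile d.+1 [::] p))) s _ Prs ch.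
    move=> s1 q [m sem]; have [//|c cp [s2 run _]] :=
      IH d.+1 [::] led1 bnd bounded_nil G s1 q m sem.
    by exists s2; apply/runs_ralt; exists c.2 => //; apply: map_f.
  exists s' => //; apply/runs_rrep; exists (size rs); split=> //.
- move=> led bnd bB G s r mu [sem ct] sB.
  have bnd1 : bounded (pvars p) by move=> x x1; apply: bnd; rewrite mem_cat x1.
  have [c cp [s' run ro]] := IH d B led bnd1 bB G s r mu sem sB.
  have [_ /(_ _ _ _ _ _ run)[_ [_ _ [so _ _]]]] := compile_sound led bnd1 bB cp.
  exists (c.1, RConc c.2 (cond_re c.1 d true t)).
    by apply/mapP; exists c.
  exists s' => //=; apply/runs_conc; exists r.2, [::], s'; rewrite cats0; split=> //.
  by rewrite (runs_cond_re _ _ _ _ _ ro so).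
Qed.

End PatternPrograms.

(** * GPC queries *)

Section PatternQueries.
Variables (Sigma : finType) (Did Dprop : Type).
Implicit Type G : dgraph Sigma Did Dprop.

Section PatternAutomaton.
Variable p : pattern Sigma.

Let maxvar := foldr maxn 0 (pvars p).
Let regs_index : finType := ('I_(rep_depth p).+1 * 'I_maxvar.+1)%type.

(** [inord] collapses indices out of range, so injectivity is claimed only within the bounds given
    by [p]. *)
Definition pattern_reg (d x : nat) : 'I_#|regs_index| :=
  enum_rank ((inord d, inord x) : regs_index).

Definition pattern_rdpa : rdpa Sigma 1 :=
  prog_rdpa (ralt (map snd (compile pattern_reg 0 [::] p))).

Lemma pattern_reg_inj d x d' x' : d <= rep_depth p -> x <= maxvar ->
  d' <= rep_depth p -> x' <= maxvar ->
  pattern_reg d x = pattern_reg d' x' -> d = d' /\ x = x'.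
Proof.
move=> ld lx ld' lx' /enum_rank_inj[/(congr1 val) Ed /(congr1 val) Ex].
by move: Ed Ex; rewrite /= !inordK.
Qed.

Lemma pvars_bounded : bounded maxvar (pvars p).
Proof.
rewrite /maxvar => x; elim: (pvars p) => //= y s IH.
by rewrite inE => /orP[/eqP->|/IH]; lia.
Qed.

Lemma pat_sem_runs G (r : rawpath G) :
  (exists mu, pat_sem p r mu) <->
  exists s', runs (ralt (map snd (compile pattern_reg 0 [::] p))) (store_init _ G) r.1 r.2 s'.
Proof.
have led : 0 + rep_depth p <= rep_depth p by [].
have nil_bounded := @bounded_nil maxvar.
split=> [[mu sem]|[s' /runs_ralt[_ /mapP[c cp ->]] H]].
  have [//|c cp [s' run _]] := compile_complete pattern_reg_inj led pvars_bounded
    nil_bounded (s := store_init _ G) sem.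
  by exists s'; apply/runs_ralt; exists c.2 => //; apply: map_f.
have [_ /(_ _ _ _ _ _ H)[mu [sem _ _]]] :=
  compile_sound Did Dprop pattern_reg_inj led pvars_bounded nil_bounded cp.
by exists mu; move: sem; case: (r).
Qed.

(** Bridges pattern semantics, stated on raw paths, and path variables, which range over valid paths
    only. *)
Lemma pat_sem_is_path G (r : rawpath G) mu : pat_sem p r mu -> is_path r.
Proof.
move=> sem; have [s' [w _ /exec_valid]] := iffLR (pat_sem_runs r) (ex_intro _ mu sem).
by [].
Qed.

Definition FPattern (k : nat) : foe Sigma := FIn pattern_rdpa (fun _ => k).

Lemma FPattern_sat k G (nu : nat -> V G) eta :
  foe_sat (FPattern k) nu eta <-> exists mu, pat_sem p (proj1_sig (eta k)) mu.
Proof.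
rewrite pat_sem_runs [foe_sat _ _ _]/= prog_rdpa_accepts; last by case: (eta k).
by split=> [[w [s' [? ?]]]|[s' [w ? ?]]]; [exists s', w | exists w, s'].
Qed.

End PatternAutomaton.

(** A repeated node shows up as two different prefixes with the same end. *)
Definition FSimple (k : nat) : foe Sigma :=
  let u := k.+1 in
  FNot (FExP u (FExP u.+1 (FAnd (FExt predT u k) (FAnd (FExt predT u.+1 k)
    (FAnd (FSameEnd Sigma u u.+1) (FNot (FPathEq u u.+1))))))).

Lemma plast_take G (r : rawpath G) i : i <= plen r ->
  plast (r.1, take i r.2) = nth r.1 (pnodes r) i.
Proof.
move=> le; rewrite /plast /pnodes /= (last_nth r.1) map_take size_takel ?size_map //.
by case: i le => //= i le; rewrite nth_take.
Qed.

Lemma is_ext_take G (r r' : rawpath G) :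
  is_ext predT r r' <-> exists2 i, i <= plen r' & r = (r'.1, take i r'.2).
Proof.
case: r r' => [v s] [v' s'] /=; split=> [[/= <- [t -> _]]|[i le [-> ->]]].
  by exists (size s); rewrite ?take_size_cat // /plen /= size_cat leq_addr.
by split=> //; exists (drop i s'); rewrite ?cat_take_drop ?all_predT.
Qed.

Lemma FSimple_sat k G (nu : nat -> V G) eta :
  foe_sat (FSimple k) nu eta <-> psimple (proj1_sig (eta k)).
Proof.
rewrite /FSimple FNot_sat FExP2_sat; set r := proj1_sig (eta k).
have E ru rw : foe_sat (FAnd (FExt predT k.+1 k) (FAnd (FExt predT k.+2 k)
      (FAnd (FSameEnd Sigma k.+1 k.+2) (FNot (FPathEq k.+1 k.+2)))))
      nu (upd (upd eta k.+1 ru) k.+2 rw) <->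
    [/\ is_ext predT (proj1_sig ru) r, is_ext predT (proj1_sig rw) r,
      plast (proj1_sig ru) = plast (proj1_sig rw) & proj1_sig ru <> proj1_sig rw].
  rewrite 3!FAnd_sat FNot_sat !FExt_sat FSameEnd_sat /=; updE.
  by split=> [[? [? [? ?]]]|[? ? ? ?]].
split=> [nex|simple [ru [rw /E[/is_ext_take[i li Eu] /is_ext_take[j lj Ew] ends]]]].
  apply/(uniqP r.1) => i j; rewrite !inE /= !size_map !ltnS => li lj Enth.
  apply/eqP/negPn/negP => /eqP nij; apply: nex.
  have [ru Eu] := gpath_take (eta k) i; have [rw Ew] := gpath_take (eta k) j.
  exists ru, rw; apply/E; rewrite Eu Ew; split.
  - by apply/is_ext_take; exists i.
  - by apply/is_ext_take; exists j.
  - by rewrite !plast_take.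
  - by case=> /(congr1 size); rewrite !size_takel.
case; rewrite Eu Ew; move: ends; rewrite Eu Ew !plast_take // => Enth.
have /(uniqP r.1) inj := simple; congr (_, take _ _).
by apply: inj; rewrite // inE /= size_map ltnS.
Qed.

(** The competitors are a parameter because [SHORTESTSIMPLE] minimises among simple matches only. *)
Definition FShortest (body : nat -> foe Sigma) (k : nat) : foe Sigma :=
  let r := k.+1 in
  FNot (FExP r (FAnd (body r) (FAnd
    (FExN 0 (FExN 1 (FAnd (FEnds 0 r 1) (FEnds 0 k 1)))) (FNot (FLe Sigma k r))))).

Lemma FShortest_sat body (B : forall G, rawpath G -> Prop) k G (nu : nat -> V G) eta :
  (forall k (eta : nat -> gpath G), foe_sat (body k) nu eta <-> B G (proj1_sig (eta k))) ->
  foe_sat (FShortest body k) nu eta <->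
  forall r : gpath G, B G (proj1_sig r) ->
    pfirst (proj1_sig r) = pfirst (proj1_sig (eta k)) ->
    plast (proj1_sig r) = plast (proj1_sig (eta k)) ->
    plen (proj1_sig (eta k)) <= plen (proj1_sig r).
Proof.
move=> bodyE; rewrite /FShortest FNot_sat.
have E r : foe_sat (FAnd (body k.+1) (FAnd
    (FExN 0 (FExN 1 (FAnd (FEnds 0 k.+1 1) (FEnds 0 k 1)))) (FNot (FLe Sigma k k.+1))))
    nu (upd eta k.+1 r) <->
    [/\ B G (proj1_sig r), pfirst (proj1_sig r) = pfirst (proj1_sig (eta k)),
      plast (proj1_sig r) = plast (proj1_sig (eta k)) &
      ~ plen (proj1_sig (eta k)) <= plen (proj1_sig r)].
  rewrite 2!FAnd_sat FNot_sat FLe_sat bodyE /=; updE.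
  split=> [[? [[x [y [[-> ->] [-> ->]]]] ?]]|[? Ef El ?]] //.
  split=> //; split=> //.
  by exists (pfirst (proj1_sig r)), (plast (proj1_sig r)).
split=> [nex r Br Ef El|min [r /E[Br Ef El]]]; last by apply; apply: min.
by apply/negPn/negP => /negP nle; apply: nex; exists r; apply/E.
Qed.

Definition FGPC (t : restrictor) (p : pattern Sigma) (k : nat) : foe Sigma :=
  FAnd (FPattern p k)
    match t with
    | SIMPLE => FSimple k
    | SHORTEST => FShortest (FPattern p) k
    | SHORTESTSIMPLE =>
        FAnd (FSimple k) (FShortest (fun r => FAnd (FPattern p r) (FSimple r)) k)
    end.

Lemma FGPC_sat t p k G (nu : nat -> V G) eta :
  foe_sat (FGPC t p k) nu eta <-> exists mu, gpc_sem t p (proj1_sig (eta k)) mu.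
Proof.
rewrite /FGPC FAnd_sat FPattern_sat.
have lift (Q : Prop) rho : (exists mu, pat_sem p rho mu) /\ Q <->
    exists mu, pat_sem (G := G) p rho mu /\ Q.
  by split=> [[[mu sem] q]|[mu [sem q]]]; [exists mu | split=> //; exists mu].
case: t; rewrite /gpc_sem -lift; [by rewrite FSimple_sat | | rewrite FAnd_sat FSimple_sat].
- rewrite (@FShortest_sat _ (fun G r => exists mu, pat_sem p r mu)); last first.
    by move=> j eta'; apply: FPattern_sat.
  split=> -[sem min]; split=> // r.
    by move=> m semr; apply: (min (exist _ r (pat_sem_is_path semr))); exists m.
  by case=> m; apply: min.
- rewrite (@FShortest_sat _ (fun G r => (exists mu, pat_sem p r mu) /\ psimple r)); last first.
    by move=> j eta'; rewrite FAnd_sat FPattern_sat FSimple_sat.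
  split=> -[sem [simple min]]; split=> //; split=> // r.
    move=> m semr sr; apply: (min (exist _ r (pat_sem_is_path semr))).
    by split=> //; exists m.
  by case=> -[m semr]; apply: min semr.
Qed.

Lemma GPC_FOERDPQ : subsumed (GPC Sigma Did Dprop) (FOERDPQ Sigma Did Dprop).
Proof.
case=> [[[p wf] t] [k|]].
  by exists (FGPC t p k) => G nu eta; apply: iff_sym; apply: FGPC_sat.
exists (FExP 0 (FGPC t p 0)) => G nu eta /=.
split=> [[rho [mu sem]]|[r /FGPC_sat[mu]]]; last by rewrite upd_same; exists (proj1_sig r), mu.
exists (exist _ rho (pat_sem_is_path sem.1)); apply/FGPC_sat; exists mu.
by rewrite upd_same.
Qed.

End PatternQueries.

(** * RDPQ inside its first-order closures, and the full list of subsumptions *)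

Lemma RDPQ_FORDPQ (Sigma : finType) (Did Dprop : Type) :
  subsumed (RDPQ Sigma Did Dprop) (FORDPQ Sigma Did Dprop).
Proof.
case=> [[x y] A].
exists (exist (fun f : foe Sigma => foe_unary f)
  (FExP 0 (FAnd (FEnds x 0 y) (FIn A (fun _ => 0)))) isT) => G nu eta /=.
split=> [[r [Ex [Ey acc]]]|[r [[Ex Ey] acc]]]; exists r; by rewrite ?upd_same in Ex Ey acc *.
Qed.

Lemma FORDPQ_FOERDPQ (Sigma : finType) (Did Dprop : Type) :
  subsumed (FORDPQ Sigma Did Dprop) (FOERDPQ Sigma Did Dprop).
Proof. by case=> phi ?; exists phi. Qed.

Theorem theorem4p1 (Sigma : finType) (Did Dprop : Type)
  (Did_infinite : forall l : list Did, exists d, ~ List.In d l)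
  (Dprop_infinite : forall l : list Dprop, exists d, ~ List.In d l) :
  (subsumed (RDPQ Sigma Did Dprop) (FORDPQ Sigma Did Dprop) /\
   subsumed (FORDPQ Sigma Did Dprop) (FOERDPQ Sigma Did Dprop)) /\
  subsumed (GPC Sigma Did Dprop) (FOERDPQ Sigma Did Dprop) /\
  subsumed (WL Sigma Did Dprop) (FOERDPQ Sigma Did Dprop) /\
  subsumed (RDPQ Sigma Did Dprop) (FOStar Sigma Did Dprop) /\
  subsumed (GXPath Sigma Did Dprop) (FOStar Sigma Did Dprop).
Proof.
split; first by split; [exact: RDPQ_FORDPQ | exact: FORDPQ_FOERDPQ].
split; first exact: GPC_FOERDPQ.
split; first exact: WL_FOERDPQ.
by split; [exact: RDPQ_FOStar | exact: GXPath_FOStar].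
Qed.
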